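(* Let $n\in\mathbb{Z}$. Consider the coupled system with a single second class particle ($d=1$), whose position is denoted $X$. Assume the coupled system is stationary with $\underline{\xi}\sim\underline{\nu}^n$. Then for any $m\in\mathbb{Z}$ the probability that the second class particle is at site $m$ is $$\mathbb{P}_{\underline{\nu}^n}(X=m)=(1-q)(q;q)_\infty\sum_{k=(m-n-1)^+}^\infty\frac{q^{k(n-m+k+1)+k+(n-m+k+1)}}{(q;q)_k(q;q)_{n-m+k+1}}.$$
   Context: Fix $q\in(0,1)$. $(x)^+=\max\{x,0\}$. $(q;q)_0=1$, $(q;q)_r=\prod_{i=1}^{r}(1-q^i)$, $(q;q)_\infty=\prod_{i=1}^\infty(1-q^i)$. For $c\in\mathbb{R}$, $\underline{\mu}^c$ is the product probability measure on $\{0,1\}^{\mathbb{Z}}$ under which the coordinates $z_i$ are independent with $\underline\mu^c(z_i=1)=\frac{q^{c-i}}{1+q^{c-i}}$. It is concentrated on the countable set $\Omega=\{\underline z\in\{0,1\}^{\mathbb{Z}}:\sum_{i\le0}z_i<\infty,\ \sum_{i\ge1}(1-z_i)<\infty\}$. For $\underline z\in\Omega$ let $N(\underline z)=\sum_{i=1}^\infty(1-z_i)-\sum_{i=-\infty}^0z_i$. For $n\in\mathbb{Z}$, $\underline\nu^n(\cdot)=\underline\mu^c(\,\cdot\mid N=n)$ (independent of $c$). ASEP: the Markov jump process $\underline\xi(t)$ on $\Omega$ in which, for every $i\in\mathbb{Z}$, a particle at $i$ jumps to $i+1$ at rate $1$ if $i+1$ is empty, and a particle at $i+1$ jumps to $i$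 at rate $q$ if $i$ is empty. The label of a particle of $\underline\xi(t)$ is the number of particles of $\underline\xi(t)$ strictly to its left; labels are $0,1,2,\dots$. Coupled system with one second class particle ($d=1$): the Markov process $(\underline\xi(t),x(t))$ on $\Omega\times\mathbb{Z}_{\ge0}$ in which $\underline\xi(t)$ evolves as ASEP and the label $x(t)$ becomes $x+1$ at rate $q$, and becomes $x-1$ at rate $1$ if $x\ge1$; in either case the move is allowed only if the two particles of $\underline\xi(t)$ whose labels are the old and new values of $x$ occupy neighbouring sites. $X(t)$ is the site of the particle of $\underline\xi(t)$ with label $x(t)$; it is the position of the second class particle. One puts $\underline\eta(t)=\underline\xi(t)-\underline\delta_{X(t)}$, where $\underline\delta_i$ is the configuration with a single particle, at site $i$. The coupled system is stationary if the law of $(\underline\xi(t),x(t))$ does not depend on $t$; $\underline\xi,\underline\eta,x,X$ denote the values at a fixed time. $\mathbb{P}_{\underline\nu^n}$ denotes probability when the coupled system is stationary with $\underline\xi\sim\underline\nu^n$. *)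

(* Defs.v *)
From mathcomp Require Import all_boot all_order all_algebra.
From mathcomp Require Import finmap.
From mathcomp Require Import all_classical all_reals all_analysis.

Set Implicit Arguments.
Unset Strict Implicit.
Unset Printing Implicit Defensive.

Import Order.TTheory GRing.Theory Num.Theory.
Import numFieldNormedType.Exports.

Local Open Scope classical_set_scope.
Local Open Scope ring_scope.

Definition qpoch (R : realType) (q : R) (r : nat) : R :=
  \prod_(1 <= i < r.+1) (1 - q ^+ i).

Definition qpoch_infty (R : realType) (q : R) : R :=
  lim (qpoch q r @[r --> \oo]).

(** [z i] holds iff site [i] is occupied. *)
Definition config : Type := int -> bool.

(** [config] with the product sigma-algebra. *)
Definition coordinate_events : set (set config) :=
  [set A | exists (i : int) (b : bool), A = [set z : config | z i = b]].

Definition mconfig := g_sigma_algebraType coordinate_events.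

(** The defining property of the product measure mu^c. *)
Definition is_product_measure (R : realType) (q c : R)
    (mu : probability mconfig R) : Prop :=
  (forall i : int, mu [set z : config | z i = true] =
     (q `^ (c - i%:~R) / (1 + q `^ (c - i%:~R)))%:E) /\
  (forall (s : seq int) (b : int -> bool), uniq s ->
     mu [set z : config | forall i : int, i \in s -> z i = b i] =
     (\prod_(i <- s) mu [set z : config | z i = b i])%E).

(** A series of zeros and ones converges iff it has finitely many ones. *)
Definition Omega : set config :=
  [set z : config | finite_set [set i : int | i <= 0 /\ z i] /\
                    finite_set [set i : int | 1 <= i /\ ~~ z i]].

(** The sums are finitely supported for [z] in [Omega], the only case used. *)
Definition N (z : config) : int :=
  \sum_(i \in [set i : int | 1 <= i]) (1 - (z i)%:Z) -
  \sum_(i \in [set i : int | i <= 0]) (z i)%:Z.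

(** mu ( . | N = n); [N] is a function on [Omega], hence the intersection. *)
Definition conditioned (R : realType) (mu : probability mconfig R) (n : int)
    (A : set mconfig) : R :=
  let E : set mconfig := [set z : config | Omega z /\ N z = n] in
  fine (mu (A `&` E)) / fine (mu E).

Definition label (z : config) (i : int) : nat :=
  #|` fset_set [set j : int | j < i /\ z j]|.

(** Site of the particle labelled [k]; it exists and is unique on [Omega]. *)
Definition position (z : config) (k : nat) : int :=
  xget 0 [set i : int | z i /\ label z i = k].

Definition exchange (z : config) (i : int) : config :=
  fun j => if j == i then z (i + 1) else if j == i + 1 then z i else z j.

(** Rate of the jump [z -> z']; on [Omega] at most finitely many [i] contribute,
    and for [z' <> z] at most one. *)
Definition asep_rate (R : realType) (q : R) (z z' : config) : R :=
  \sum_(i \in [set: int])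
    (if z' == exchange z i then
       if z i && ~~ z (i + 1) then 1
       else if ~~ z i && z (i + 1) then q
       else 0
     else 0).

Definition neighbours (z : config) (k l : nat) : bool :=
  `|position z k - position z l| == 1.

Definition label_rate (R : realType) (q : R) (z : config) (k l : nat) : R :=
  if neighbours z k l then
    if l == k.+1 then q else if k == l.+1 then 1 else 0
  else 0.

Definition state : Type := (Omega * nat)%type.

(** ASEP jumps keep the label, label jumps keep the configuration. *)
Definition coupled_rate (R : realType) (q : R) (a b : state) : R :=
  (if a.2 == b.2 then asep_rate q (val a.1) (val b.1) else 0) +
  (if a.1 == b.1 then label_rate q (val a.1) a.2 b.2 else 0).

Definition second_class_site (a : state) : int := position (val a.1) a.2.

(** Honest standard transition function on the countable set [S] whose
    derivative at time 0 is the conservative Q-matrix with off-diagonal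
    entries [rate]. *)
Record transition_function (R : realType) (S : choiceType)
    (rate : S -> S -> R) (p : R -> S -> S -> R) : Prop := {
  tf_ge0 : forall (t : R) a b, 0 <= t -> 0 <= p t a b;
  tf_sum1 : forall (t : R) a, 0 <= t -> \esum_(b in [set: S]) (p t a b)%:E = 1%E;
  tf_0 : forall a b, p 0 a b = (a == b)%:R;
  tf_CK : forall (s t : R) a b, 0 <= s -> 0 <= t ->
    (p (s + t) a b)%:E = \esum_(e in [set: S]) (p s a e * p t e b)%:E;
  tf_jump : forall a b, a != b -> p h a b / h @[h --> 0^'+] --> rate a b;
  tf_exit : forall a,
    ((1 - p h a a) / h)%:E @[h --> 0^'+] -->
    \esum_(b in [set b | b != a]) (rate a b)%:E
}.

(** Time-homogeneous continuous-time Markov jump process with jump rates [rate],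
    on a countable state space with the discrete sigma-algebra and topology. In
    the Markov property, [h] lists finitely many (time, state) pairs of the
    past. *)
Definition markov_jump_process (R : realType) (d : measure_display)
    (T : measurableType d) (P : probability T R) (S : choiceType)
    (rate : S -> S -> R) (Z : R -> T -> S) : Prop :=
  [/\ (forall (t : R) (A : set S), 0 <= t -> measurable [set w | A (Z t w)]),
      {ae P, forall w, forall t : R, 0 <= t ->
         \forall s \near t^'+, Z s w = Z t w} &
      exists2 p : R -> S -> S -> R, transition_function rate p &
        forall (h : seq (R * S)) (s t : R) (a b : S),
          (forall u : R * S, u \in h -> 0 <= u.1 <= s) -> 0 <= s -> 0 <= t ->
          let past := [set w | forall u : R * S, u \in h -> Z u.1 w = u.2] in
          P (past `&` [set w | Z s w = a] `&` [set w | Z (s + t) w = b]) =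
          (P (past `&` [set w | Z s w = a]) * (p t a b)%:E)%E].

Definition stationary (R : realType) (d : measure_display)
    (T : measurableType d) (P : probability T R) (S : Type)
    (Z : R -> T -> S) : Prop :=
  forall (t : R) (A : set S), 0 <= t ->
    P [set w | A (Z t w)] = P [set w | A (Z 0 w)].

(* Main.v *)
Require Import Defs.
From mathcomp Require Import all_boot all_order all_algebra.
From mathcomp Require Import finmap.
From mathcomp Require Import all_classical all_reals all_analysis.
From mathcomp Require Import zify ring lra.

Set Implicit Arguments.
Unset Strict Implicit.
Unset Printing Implicit Defensive.

Import Order.TTheory GRing.Theory Num.Theory.
Import numFieldNormedType.Exports.

Local Open Scope classical_set_scope.
Local Open Scope ring_scope.

(** The coupled chain is reversible with respect to the weights
    [mu {xi} * q ^ x], so the point is to identify the stationary law of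
    [(xi, x)] with [nu^n] times a geometric law, and then to compute
    [nu^n (the particle with label k is at m)].

    Identification.  Letting [h -> 0+] in the invariance of the law [v] under
    the transition function gives that [v] is sub-invariant for the jump rates,
    and hence so is [min(v, C w)] for the reversible weight [w] and every
    [C >= 0].  Its total flux is finite, because the expected number of sites
    with [z i <> z (i + 1)] is, so it is invariant; this forces [v / w] to be
    constant along edges.  Exchanges 10 -> 01 connect every configuration with
    [N = n] to the step configuration, at which all labels communicate.

    Computation.  Pushing all particles left of [m] one site to the left
    multiplies the weight by [q ^ k], where [k] is their number.  This gives a
    recursion for [nu^n (k particles are left of m)], which is solved using that
    almost surely all sites far to the right are occupied. *)

(** * Sums over arbitrary index types and reversible rates *)

Lemma esum_exchange (R : realType) (S T : choiceType) (I : set S) (J : set T)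
    (f : S -> T -> \bar R) :
  (forall a b, (0 <= f a b)%E) ->
  (\esum_(a in I) \esum_(b in J) f a b =
   \esum_(b in J) \esum_(a in I) f a b)%E.
Proof.
move=> f0; rewrite !esum_esum//.
rewrite (@reindex_esum _ _ _ (I `*`` (fun=> J)) (J `*`` (fun=> I))
  (fun k => (k.2, k.1)))//.
split => //=; first by move=> [a b] [].
  by move=> [a b] [a' b'] _ _ /= [-> ->].
by move=> [b a] [Jb Ia]; exists (a, b).
Qed.

Lemma esum_indic_le1 (R : realType) (S : choiceType) (P : pred S) :
  (forall a b, P a -> P b -> a = b) ->
  (\esum_(a in [set: S]) (P a)%:R%:E <= 1 :> \bar R)%E.
Proof.
move=> P1; have [[a Pa]|noP] := pselect (exists a, P a).
  rewrite (esumID [set a])// setTI esum_set1// Pa esum1 ?adde0// => b [_ /= ba].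
  by rewrite (negbTE (_ : ~~ P b))//; apply/negP => Pb; apply: ba; exact: P1.
rewrite esum1// => a _; rewrite (negbTE (_ : ~~ P a))//.
by apply/negP => Pa; apply: noP; exists a.
Qed.

Lemma esum_geometric (R : realType) (q : R) : 0 <= q < 1 ->
  (\esum_(k in [set: nat]) (q ^+ k)%:E = ((1 - q)^-1)%:E)%E.
Proof.
move=> /andP[q0 q1]; rewrite -nneseries_esumT; last first.
  by move=> k; rewrite lee_fin exprn_ge0.
apply/cvg_lim => //.
have := @cvg_geometric_series R 1 q; rewrite ger0_norm// mul1r => /(_ q1) h.
under eq_fun do rewrite sumEFin.
apply: cvg_EFin; first exact: nearW.
apply: cvg_trans h; apply: near_eq_cvg; apply: nearW => n.
by rewrite /series/=; apply: eq_bigr => k _; rewrite /geometric/= mul1r.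
Qed.

Lemma esum_int (R : realType) (f : int -> \bar R) : (forall i, (0 <= f i)%E) ->
  (\esum_(i in [set: int]) f i =
   \esum_(k in [set: nat]) f k%:Z + \esum_(k in [set: nat]) f (Negz k))%E.
Proof.
move=> f0; rewrite (esumID [set i | 0 <= i])// !setTI; congr (_ + _)%E.
  apply: (@reindex_esum _ _ _ [set: nat] _ Posz); split => //=.
    by move=> x y _ _ [].
  by move=> [k|k]// _; exists k.
apply: (@reindex_esum _ _ _ [set: nat] _ Negz); split => //=.
  by move=> x y _ _ [].
by move=> [k|k] /= hk; [case: hk|exists k].
Qed.

(** A strict inequality at one index would survive in the totals, because the sum over the remaining
    indices is finite and can be cancelled. *)
Lemma esum_le_eq (R : realType) (S : choiceType) (f g : S -> \bar R) :
  (forall a, (0 <= f a)%E) -> (forall a, (f a <= g a)%E) ->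
  (\esum_(a in [set: S]) f a = \esum_(a in [set: S]) g a)%E ->
  (\esum_(a in [set: S]) f a < +oo)%E ->
  f =1 g.
Proof.
move=> f0 fg eq_fg foo a.
have g0 x : (0 <= g x)%E := le_trans (f0 x) (fg x).
apply/eqP; rewrite eq_le fg /= leNgt; apply/negP => ltfg.
move: eq_fg foo.
rewrite !(esumID [set a] [set: S])// !setTI !esum_set1// => eq_fg foo.
have : (f a + \esum_(i in ~` [set a]) f i <
        g a + \esum_(i in ~` [set a]) g i)%E.
  apply: lte_leD => //; last by apply: le_esum => *.
  rewrite ge0_fin_numE ?esum_ge0//.
  by apply: le_lt_trans foo; rewrite leeDr.
by rewrite eq_fg ltxx.
Qed.

(** Used in two ways: with [f := id] it splits subsets of [Omega] into single configurations, and
    with [f := Z 0] it splits events into single states. *)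
Lemma measure_countable_preimage (R : realType) (d : measure_display)
    (T : measurableType d) (mu : {measure set T -> \bar R}) (S : choiceType)
    (f : T -> S) (A : set S) :
  countable A -> (forall s, A s -> measurable (f @^-1` [set s])) ->
  (mu (f @^-1` A) = \esum_(s in A) mu (f @^-1` [set s]))%E.
Proof.
elim/choicePpointed: S => S in f A *.
  by move=> _ _; rewrite !emptyE preimage_set0 measure0 esum_set0.
move=> /countable_bijP[B]; rewrite card_eq_sym => BA mf.
have [e eBA] := card_set_bijP BA.
rewrite (@reindex_esum _ _ _ B A e _ eBA).
rewrite -[B in \esum_(_ in B) _]set_mem_set -nneseries_esum//.
rewrite -(measure_bigcup mu B (fun k => f @^-1` [set e k])).
- congr (mu _); apply/seteqP; split => [t At|t [k Bk] /= ->].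
    have [k Bk ek] : (e @` B) (f t) by exact: (set_bij_surj eBA).
    by exists k.
  exact: (set_bij_homo eBA).
- by move=> k Bk; apply: mf; exact: (set_bij_homo eBA).
- apply/trivIsetP => i j Bi Bj /eqP ij; apply/seteqP; split => // t [/= fi fj].
  apply: ij; apply: (set_bij_inj eBA); rewrite ?inE//.
  by rewrite -fi -fj.
Qed.

Lemma ge0_esumZl (R : realType) (S : choiceType) (A : set S) (c : R)
    (f : S -> \bar R) :
  0 <= c -> (forall a, (0 <= f a)%E) ->
  (\esum_(a in A) (c%:E * f a) = c%:E * \esum_(a in A) f a)%E.
Proof.
move=> + f0.
have le (e : R) (g : S -> \bar R) : 0 <= e -> (forall a, (0 <= g a)%E) ->
    (\esum_(a in A) (e%:E * g a) <= e%:E * \esum_(a in A) g a)%E.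
  move=> e0 g0; apply: ge_ereal_sup => /= _ [X XA <-].
  rewrite -ge0_mule_fsumr//; apply: lee_wpmul2l; first by rewrite lee_fin.
  by apply: esum_ge; exists X.
rewrite le_eqVlt => /predU1P[<-|c0].
  by rewrite mul0e esum1// => a _; rewrite mul0e.
apply/eqP; rewrite eq_le le ?(ltW c0)//=.
(* The reverse inequality is [le] again, for the scalar [c^-1] and the family already multiplied by
   [c]. *)
rewrite -lee_pdivlMl//.
have := le c^-1 (fun a => (c%:E * f a)%E).
under [X in _ -> _ -> (X <= _)%E]eq_esum do
  rewrite muleA -EFinM mulVf ?gt_eqF// mul1e.
by apply; rewrite ?invr_ge0 ?ltW// => a; rewrite mule_ge0// lee_fin ltW.
Qed.

(* At a state [a], put [c = v a / w a] and [h = min(v, c w)].  Then [h] is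
   sub-invariant and the two sides of the sub-invariance inequality have the
   same finite total sum, so [h] is invariant; as [h = c w] at [a], this forces
   [h = c w] at all neighbours of [a]. *)
Lemma reversible_ratio_le (R : realType) (S : choiceType) (K : S -> S -> R)
    (w v : S -> R) :
  (forall a b, 0 <= K a b) -> (forall a, 0 < w a) -> (forall a, 0 <= v a) ->
  (forall a b, w a * K a b = w b * K b a) ->
  (\esum_(a in [set: S]) \esum_(b in [set: S]) (w a * K a b)%:E < +oo)%E ->
  (forall b, (\esum_(a in [set: S]) (v a * K a b)%:E <=
              \esum_(a in [set: S]) (v b * K b a)%:E)%E) ->
  forall a b, 0 < K a b -> v a * w b <= v b * w a.
Proof.
move=> K0 w0 v0 bal fin sub a b Kab.
pose c := v a / w a; pose h x := Num.min (v x) (c * w x).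
have c0 : 0 <= c by rewrite divr_ge0// ltW.
have h0 x : 0 <= h x by rewrite le_min v0 mulr_ge0// ltW.
have hE x y : (0 <= (h x * K x y)%:E)%E by rewrite lee_fin mulr_ge0.
have hcw x : h x <= c * w x by rewrite ge_min lexx orbT.
(* Where [h = v], the inflow is at most that of [v]; where [h = c w], it is at most that of [c w],
   which detailed balance turns into outflow. *)
have hsub x : (\esum_(y in [set: S]) (h y * K y x)%:E <=
               \esum_(y in [set: S]) (h x * K x y)%:E)%E.
  have [lvx|lvx] := leP (v x) (c * w x).
    have -> : h x = v x by rewrite /h; apply/min_idPl.
    apply: le_trans (sub x); apply: le_esum => y _.
    by rewrite lee_fin ler_wpM2r// ge_min lexx.
  have -> : h x = c * w x by rewrite /h; apply/min_idPr/ltW.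
  apply: le_esum => y _.
  by rewrite lee_fin -mulrA bal mulrA ler_wpM2r.
have htot : (\esum_(x in [set: S]) \esum_(y in [set: S]) (h y * K y x)%:E =
    \esum_(x in [set: S]) \esum_(y in [set: S]) (h x * K x y)%:E)%E.
  by rewrite esum_exchange.
have cfin : (\esum_(x in [set: S]) \esum_(y in [set: S])
    (h y * K y x)%:E < +oo)%E.
  have : (c%:E * (\esum_(a in [set: S]) \esum_(b in [set: S]) (w a * K a b)%:E)
      < +oo)%E.
    by rewrite lte_mul_pinfty// lee_fin.
  apply: le_lt_trans; rewrite htot -ge0_esumZl//; last first.
    by move=> x; apply: esum_ge0 => y _; rewrite lee_fin mulr_ge0// ltW.
  apply: le_esum => x _; rewrite -ge0_esumZl//; last first.
    by move=> y; rewrite lee_fin mulr_ge0// ltW.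
  by apply: le_esum => y _; rewrite -EFinM lee_fin mulrA ler_wpM2r.
have eqh := esum_le_eq (fun x => esum_ge0 (fun y _ => hE y x)) hsub htot cfin.
have ha : h a = c * w a.
  by rewrite /h /c divfK ?gt_eqF// minxx.
(* Invariance of [h] at [a] and detailed balance give both families the same sum, and one dominates
   the other termwise, so they coincide. *)
have hab x : (h x * K x a)%:E = (c * w x * K x a)%:E.
  apply: (esum_le_eq (f := fun x => (h x * K x a)%:E)
    (g := fun x => (c * w x * K x a)%:E)) => [y|y||].
  - exact: hE.
  - by rewrite lee_fin ler_wpM2r.
  - by rewrite eqh; apply: eq_esum => y _; rewrite ha -!mulrA bal.
  - apply: le_lt_trans cfin.
    rewrite [leRHS](esumID [set a])// ?setTI ?esum_set1.
    + by rewrite leeDl// esum_ge0// => y _; exact: esum_ge0.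
    + exact: esum_ge0.
    + by move=> y _; exact: esum_ge0.
have Kba : 0 < K b a.
  by rewrite -(pmulr_rgt0 _ (w0 b)) -bal mulr_gt0.
move: (hab b) => [] /(mulIf (lt0r_neq0 Kba)) hb.
have : c * w b <= v b by rewrite -hb ge_min lexx.
by rewrite /c mulrAC ler_pdivrMr.
Qed.

(** Detailed balance makes positivity of a rate symmetric, so the one-sided bound applies in both
    directions. *)
Lemma reversible_ratio_eq (R : realType) (S : choiceType) (K : S -> S -> R)
    (w v : S -> R) :
  (forall a b, 0 <= K a b) -> (forall a, 0 < w a) -> (forall a, 0 <= v a) ->
  (forall a b, w a * K a b = w b * K b a) ->
  (\esum_(a in [set: S]) \esum_(b in [set: S]) (w a * K a b)%:E < +oo)%E ->
  (forall b, (\esum_(a in [set: S]) (v a * K a b)%:E <=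
              \esum_(a in [set: S]) (v b * K b a)%:E)%E) ->
  forall a b, 0 < K a b -> v a / w a = v b / w b.
Proof.
move=> K0 w0 v0 bal fin sub a b Kab.
have Kba : 0 < K b a by rewrite -(pmulr_rgt0 _ (w0 b)) -bal mulr_gt0.
have le x y : 0 < K x y -> v x * w y <= v y * w x.
  exact: reversible_ratio_le.
apply/eqP; rewrite eqr_div ?lt0r_neq0//.
by rewrite eq_le !le.
Qed.

(** The events of starting in some [a] of [X] and ending in [b] are disjoint parts of the event of
    being in [b] at time [t]. A finite [X] is enough, and it lets the limit at time 0 be taken term
    by term. *)
Lemma transition_subinvariant (R : realType) (d : measure_display)
    (T : measurableType d) (P : probability T R) (S : choiceType)
    (Z : R -> T -> S) (p : R -> S -> S -> R) :
  (forall (t : R) (A : set S), 0 <= t -> measurable [set w | A (Z t w)]) ->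
  stationary P Z ->
  (forall (t : R) (a b : S), 0 <= t ->
    P ([set w | Z 0 w = a] `&` [set w | Z t w = b]) =
    (P [set w | Z 0%R w = a] * (p t a b)%:E)%E) ->
  forall (t : R) (b : S) (X : set S), 0 <= t -> finite_set X ->
  \sum_(a \in X) fine (P [set w | Z 0 w = a]) * p t a b <=
  fine (P [set w | Z 0 w = b]).
Proof.
move=> mZ sZ jZ t b X t0 finX.
have mZ0 a : measurable [set w | Z 0 w = a] by exact: (mZ 0 [set a]).
have mZt a : measurable [set w | Z t w = a] by exact: (mZ t [set a]).
rewrite -lee_fin fineK ?fin_num_measure//.
have /= <- := sZ t [set b] t0.
pose F a := [set w | Z 0 w = a] `&` [set w | Z t w = b].
have mF a : measurable (F a) by exact: measurableI.
apply: (@le_trans _ _ (P (\bigcup_(a in X) F a))); last first.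
  apply: le_measure; rewrite ?inE//; first exact: fin_bigcup_measurable.
  by apply: bigcup_sub => a _ w [].
rewrite measure_fin_bigcup//; last first.
  by move=> i j _ _ [w [[/= <- _] [/= <- _]]].
rewrite !fsbig_finite//= -sumEFin le_eqVlt; apply/orP; left; apply/eqP.
by apply: eq_bigr => a _; rewrite jZ// EFinM fineK// fin_num_measure.
Qed.

Lemma stationary_rate_subinvariant (R : realType) (d : measure_display)
    (T : measurableType d) (P : probability T R) (S : choiceType)
    (rate : S -> S -> R) (Z : R -> T -> S) :
  markov_jump_process P rate Z -> stationary P Z ->
  (forall a, rate a a = 0) -> (forall a b, 0 <= rate a b) ->
  forall b, (\esum_(a in [set: S]) (rate b a)%:E < +oo)%E ->
  (\esum_(a in [set: S]) (fine (P [set w | Z 0%R w = a]) * rate a b)%:E <=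
   \esum_(a in [set: S]) (fine (P [set w | Z 0%R w = b]) * rate b a)%:E)%E.
Proof.
move=> [mZ _ [p [_ _ _ _ pjump pexit] pmk]] sZ rate0 rate_ge0 b finb.
(* This is the Markov property with an empty past and starting time 0. *)
have jZ (t : R) a e : 0 <= t ->
    P ([set w | Z 0 w = a] `&` [set w | Z t w = e]) =
    (P [set w | Z 0%R w = a] * (p t a e)%:E)%E.
  move=> t0; have /= := pmk [::] 0 t a e _ (lexx 0) t0.
  rewrite add0r (_ : [set w | _] = setT) ?setTI; first by apply.
  by apply/seteqP; split.
set v := fun a => fine (P [set w | Z 0 w = a]).
have v0 a : 0 <= v a by exact: fine_ge0.
have exitE : (\esum_(a in [set: S]) (rate b a)%:E =
    \esum_(a in [set a | a != b]) (rate b a)%:E)%E.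
  rewrite [RHS]esum_mkcond; apply: eq_esum => a _.
  by case: ifPn => //; rewrite notin_setE => /negP/negPn/eqP ->; rewrite rate0.
have := pexit b; rewrite -exitE.
set e := (\esum_(a in [set: S]) (rate b a)%:E)%E.
have e0 : (0 <= e)%E by apply: esum_ge0 => a _; rewrite lee_fin.
have -> : e = (fine e)%:E by rewrite fineK// ge0_fin_numE.
move=> /fine_cvgP[_ cvge].
have -> : (\esum_(a in [set: S]) (v b * rate b a)%:E = (v b * fine e)%:E)%E.
  under eq_esum => x _ do rewrite EFinM.
  rewrite ge0_esumZl//; last by move=> a; rewrite lee_fin.
  by rewrite EFinM -/e (@fineK _ e)// ge0_fin_numE.
have -> : (\esum_(a in [set: S]) (v a * rate a b)%:E =
    \esum_(a in [set a | a != b]) (v a * rate a b)%:E)%E.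
  rewrite [RHS]esum_mkcond; apply: eq_esum => a _.
  case: ifPn => //; rewrite notin_setE => /negP/negPn/eqP ->.
  by rewrite rate0 mulr0.
apply: ge_ereal_sup => /= _ [X [finX Xb] <-].
rewrite fsbig_finite//= sumEFin lee_fin.
have cvgl : \sum_(a <- fset_set X) v a * (p h a b / h) @[h --> 0^'+] -->
    \sum_(a <- fset_set X) v a * rate a b.
  rewrite (_ : (fun _ => _) =
    (fun h => \sum_(a <- fset_set X | a \in fset_set X) v a * (p h a b / h)));
    last by apply/funext => h; rewrite big_seq.
  rewrite [X in _ --> X]big_seq.
  apply: cvg_big => [|a]; first exact: add_continuous.
  rewrite in_fset_set// inE => /Xb /= ab.
  by apply: cvgMl_tmp; exact: pjump.
have cvgr : v b * ((1 - p h b b) / h) @[h --> 0^'+] --> v b * fine e.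
  exact: cvgMl_tmp.
apply: ler_cvg_to cvgl cvgr _.
near=> h.
have h0 : 0 < h by near: h; exact: nbhs_right_gt.
have Xbb : ~ X b by move=> /Xb /=; rewrite eqxx.
(* The starting state [b] is adjoined to [X]. Moving its term to the other side leaves
   [v b * (1 - p h b b)], whose quotient by [h] tends to the exit rate. *)
have finbX : finite_set ([set b] `|` X) by rewrite finite_setU.
have := transition_subinvariant mZ sZ jZ b (ltW h0) finbX.
rewrite fsbigU0 ?fsbig_set1//; last by move=> x [/= ->].
rewrite fsbig_finite//= -!/(v _) => le_vb.
under eq_bigr do rewrite mulrA.
by rewrite -mulr_suml mulrA ler_pM2r ?invr_gt0// mulrBr mulr1 lerBrDl.
Unshelve. all: by end_near.
Qed.

(** * q-Pochhammer symbols and the recursion they solve *)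

Lemma qpochS (R : realType) (q : R) (k : nat) :
  qpoch q k.+1 = qpoch q k * (1 - q ^+ k.+1).
Proof. by rewrite /qpoch big_nat_recr. Qed.

Lemma qpoch_gt0 (R : realType) (q : R) (k : nat) : 0 < q < 1 -> 0 < qpoch q k.
Proof.
move=> /andP[q0 q1]; elim: k => [|k IH]; first by rewrite /qpoch big_geq.
by rewrite qpochS mulr_gt0// subr_gt0 exprn_ilt1// ltW.
Qed.

Lemma qpoch_le1 (R : realType) (q : R) (k : nat) : 0 < q < 1 -> qpoch q k <= 1.
Proof.
move=> q01; have /andP[q0 q1] := q01.
elim: k => [|k IH]; first by rewrite /qpoch big_geq.
rewrite qpochS mulr_ile1//.
- by rewrite ltW// qpoch_gt0.
- by rewrite subr_ge0 exprn_ile1// ltW.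
- by rewrite gerBl exprn_ge0// ltW.
Qed.

(* [(q;q)_k h k r] minus its claimed value does not depend on [k] and tends
   to [0] as [k] grows. *)
Lemma qpoch_recursion (R : realType) (q : R) (h : nat -> nat -> R) :
  0 < q < 1 -> (forall k r, 0 <= h k r) ->
  (forall k, h k 0%N = (1 - q ^+ k.+1) * h k.+1 0%N) ->
  (forall k r, h k r.+1 = q ^+ k * h k r + (1 - q ^+ k.+1) * h k.+1 r.+1) ->
  h k 0%N @[k --> \oo] --> (1 : R) ->
  (forall r, h k r.+1 @[k --> \oo] --> (0 : R)) ->
  forall k r, h k r = qpoch_infty q * q ^+ (k * r) / (qpoch q k * qpoch q r).
Proof.
move=> q01 h0 rec0 rec lim1 lim0; have /andP[q0 q1] := q01.
have p0 k : 0 < qpoch q k by exact: qpoch_gt0.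
have pn0 k : qpoch q k != 0 by rewrite gt_eqF.
pose e k r := qpoch q k * h k r - qpoch_infty q * q ^+ (k * r) / qpoch q r.
suff e0 : forall r k, e k r = 0.
  move=> k r; have := e0 r k; rewrite /e => /eqP; rewrite subr_eq0 => /eqP hk.
  by rewrite -[LHS](mulKf (pn0 k)) hk; field; rewrite !pn0.
have const (f : nat -> R) : (forall k, f k = f k.+1) ->
    f @ \oo --> (0 : R) -> forall k, f k = 0.
  move=> fS f0 k; have fE j : f j = f 0%N by elim: j => // j <-.
  rewrite fE; apply: (cvg_unique (@norm_hausdorff _ R) _ f0) => //.
  by rewrite (_ : f = fun=> f 0%N); [exact: cvg_cst|exact/funext].
elim=> [|r IH].
  have cE k : qpoch q k * h k 0%N = h 0%N 0%N.
    elim: k => [|k <-]; first by rewrite /qpoch big_geq// mul1r.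
    by rewrite (rec0 k) qpochS mulrA.
  (* Since [h k 0] tends to 1, the products [qpoch q k = h 0 0 / h k 0] converge to [h 0 0]; this
     also shows that the limit defining [qpoch_infty] exists. *)
  have qE : qpoch_infty q = h 0%N 0%N.
    apply: (cvg_lim (@norm_hausdorff _ R)).
    have lim : h 0%N 0%N * (h k 0%N)^-1 @[k --> \oo] --> h 0%N 0%N.
      have := cvgMl_tmp (a := h 0%N 0%N) (cvgV (oner_neq0 R) lim1).
      by rewrite invr1 mulr1; apply.
    apply: (cvg_trans _ lim).
    apply: near_eq_cvg; near=> k.
    have hk : h k 0%N != 0.
      rewrite gt_eqF//; near: k.
      by apply: (cvgr_gt _ lim1); exact: ltr01.
    by rewrite -(cE k) mulfK.
  by move=> k; rewrite /e cE qE muln0 expr0 mulr1 /qpoch big_geq// divr1 subrr.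
apply: (const (fun k => e k r.+1)) => [k|].
  (* The closed form for [r] replaces [h k r] in the recursion, which then says that
     [e k r.+1 = e k.+1 r.+1]. *)
  have := IH k; rewrite /e => /eqP; rewrite subr_eq0 => /eqP hk.
  have r1 : 1 - q ^+ r.+1 != 0.
    by rewrite gt_eqF// subr_gt0 exprn_ilt1// ltW.
  rewrite rec mulrDr mulrCA hk !qpochS mulnS mulSn mulnS !exprD.
  by move: r1; rewrite !exprS => r1; field; rewrite pn0 r1.
have lim1' : qpoch q k * h k r.+1 @[k --> \oo] --> (0 : R).
  apply: (squeeze_cvgr (f := fun=> 0) (h := fun k => h k r.+1)).
  - apply: nearW => ?; apply/andP; split; first by rewrite mulr_ge0// ltW// p0.
    by rewrite ler_piMl// qpoch_le1.
  - exact: cvg_cst.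
  - exact: lim0.
have lim2 : qpoch_infty q * q ^+ (k * r.+1) / qpoch q r.+1 @[k --> \oo] -->
    (0 : R).
  have : `|q ^+ r.+1| < 1.
    by rewrite ger0_norm ?exprn_ge0 ?ltW// exprn_ilt1// ltW.
  move/cvg_expr => lim2.
  have := cvgMr_tmp (b := (qpoch q r.+1)^-1)
    (cvgMl_tmp (a := qpoch_infty q) lim2).
  rewrite mulr0 mul0r; under eq_fun do rewrite -exprM mulnC.
  exact.
by have := cvgB lim1' lim2; rewrite subr0; exact.
Unshelve. all: by end_near.
Qed.

(** * Configurations, labels and moves *)

(** A quantitative form of membership in [Omega], by [OmegaP]. *)
Definition window (z : config) (M : nat) : Prop :=
  forall i : int, (i < - M%:Z -> ~~ z i) /\ (M%:Z <= i -> z i).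

Lemma window_ge (z : config) (M : nat) (i : int) :
  window z M -> z i -> - M%:Z <= i.
Proof.
move=> zM zi; rewrite leNgt; apply/negP => iM.
by have [/(_ iM)/negP] := zM i.
Qed.

Lemma window_lt (z : config) (M : nat) (i : int) :
  window z M -> ~~ z i -> i < M%:Z.
Proof.
move=> zM; apply: contraNT; rewrite -leNgt => Mi.
by have [_ ->] := zM i.
Qed.

Lemma finite_int_bound (A : set int) : finite_set A ->
  exists M : nat, forall i, A i -> (absz i <= M)%N.
Proof.
move=> finA; exists (\sum_(i <- fset_set A) absz i)%N => i Ai.
rewrite (big_fsetD1 i)/=; first exact: leq_addr.
by rewrite in_fset_set// inE.
Qed.

Lemma finite_int_itv (a b : int) : finite_set [set i : int | a <= i < b].
Proof.
apply: (@sub_finite_set _ _ ((fun k : nat => a + k%:Z) @` `I_(absz (b - a)))).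
  by move=> i /= /andP[ai ib]; exists (absz (i - a)) => /=; lia.
exact/finite_image/finite_II.
Qed.

Lemma OmegaP (z : config) : Omega z <-> exists M, window z M.
Proof.
split=> [[/finite_int_bound[M zM] /finite_int_bound[M' zM']]|[M zM]].
  exists (M + M').+1 => i; split => hi.
    apply/negP => zi; suff : (absz i <= M)%N by lia.
    by apply: zM; split => //; lia.
  apply/negPn/negP => zi; suff : (absz i <= M')%N by lia.
  by apply: zM'; split => //; lia.
split.
  apply: sub_finite_set (finite_int_itv (- M%:Z) 1) => i /= [i0 zi].
  by have := window_ge zM zi; lia.
apply: sub_finite_set (finite_int_itv 1 M%:Z) => i /= [i0 zi].
by have := window_lt zM zi; lia.
Qed.

Lemma finite_left (z : config) (i : int) :
  Omega z -> finite_set [set j : int | j < i /\ z j].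
Proof.
move=> /OmegaP[M zM]; apply: sub_finite_set (finite_int_itv (- M%:Z) i) => j /=.
by move=> [ji zj]; have := window_ge zM zj; lia.
Qed.

Lemma eq_label (z z' : config) (i : int) :
  (forall j, j < i -> z j = z' j) -> label z i = label z' i.
Proof.
move=> zz'; rewrite /label; congr (#|` fset_set _|); apply/seteqP.
by split => j /= [ji]; rewrite zz'.
Qed.

Lemma label_low (z : config) (i : int) :
  (forall j, j < i -> ~~ z j) -> label z i = 0%N.
Proof.
move=> zi; rewrite /label (_ : [set _ | _] = set0) ?fset_set0 ?cardfs0//.
by apply/seteqP; split => j //= [/zi/negP].
Qed.

(** Later label computations rest on this increment rule rather than on cardinalities. *)
Lemma label_succ (z : config) (i : int) : Omega z ->
  label z (i + 1) = (label z i + z i)%N.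
Proof.
move=> Oz; have fin j := finite_left j Oz.
rewrite /label; case: (boolP (z i)) => zi.
  rewrite (_ : [set j | j < i + 1 /\ z j] =
    [set i] `|` [set j | j < i /\ z j]).
    rewrite fset_setU ?fset_set1// cardfsU1 in_fset_set//.
    rewrite (_ : i \notin _) ?addn1 ?add1n//.
    by rewrite notin_setE /= => -[]; rewrite ltxx.
  apply/seteqP; split => j /=.
    have [->|ji] := eqVneq j i; first by left.
    by move=> [? ?]; right; split => //; lia.
  by move=> [->|[? ?]]; split => //; lia.
rewrite addn0; congr (#|` fset_set _|); apply/seteqP; split => j /= [ji zj].
  split => //; have [ji'|//] := eqVneq j i; first by rewrite -ji' zj in zi.
  by lia.
by split => //; lia.
Qed.

Lemma label_le (z : config) (i j : int) : Omega z ->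
  i <= j -> (label z i <= label z j)%N.
Proof.
move=> Oz ij; have [k ->] : exists k : nat, j = i + k%:Z.
  by exists (absz (j - i)); lia.
elim: k => [|k IH]; first by rewrite addr0.
rewrite (_ : i + k.+1%:Z = i + k%:Z + 1); last by lia.
by rewrite label_succ// (leq_trans IH)// leq_addr.
Qed.

Lemma label_addn (z : config) (i : int) (k : nat) : Omega z ->
  label z (i + k%:Z) = (label z i + \sum_(j < k) z (i + j%:Z)%R)%N.
Proof.
move=> Oz; elim: k => [|k IH]; first by rewrite big_ord0 addn0 addr0.
rewrite (_ : i + k.+1%:Z = i + k%:Z + 1); last by lia.
by rewrite big_ord_recr /= addnA -IH -label_succ.
Qed.

Lemma label_subn (z : config) (i : int) (k : nat) : Omega z ->
  label z (i + 1) = (label z (i + 1 - k%:Z)%R + \sum_(j < k) z (i - j%:Z)%R)%N.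
Proof.
move=> Oz; elim: k => [|k IH]; first by rewrite big_ord0 addn0 subr0.
rewrite big_ord_recr /= IH; have := label_succ (i - k%:Z) Oz.
rewrite (_ : i + 1 - k.+1%:Z = i - k%:Z); last by lia.
rewrite (_ : i + 1 - k%:Z = i - k%:Z + 1); last by lia.
by move=> ->; rewrite addnAC addnA.
Qed.

(** There are no holes from [i] on, so the holes at positive sites number [i - 1] minus the
    particles on [[1, i - 1]]; subtracting the particles at sites up to 0 leaves [i - 1] minus all
    particles left of [i]. *)
Lemma N_label (z : config) (M : nat) (i : int) :
  window z M -> M%:Z < i -> N z = i - 1 - (label z i)%:Z.
Proof.
move=> zM; have Oz : Omega z by apply/OmegaP; exists M.
have iotaE k : iota 0 k = index_iota 0 k by rewrite /index_iota subn0.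
(* The case [i = 1 + M] is done first, with both sums of [N] written over the explicit lists
   [1, ..., M] and [0, -1, ..., -M]. *)
have NM : N z = M%:Z - (label z (1 + M%:Z))%:Z.
  rewrite /N.
  rewrite (fsbigE [seq 1 + j%:Z | j <- iota 0 M]); last 3 first.
  - by rewrite map_inj_uniq ?iota_uniq// => j k; lia.
  - by move=> j /= /mapP[k _ ->]; lia.
  - move=> j j1 hj; apply/eqP; rewrite subr_eq0; apply/eqP.
    have [_ ->//] := zM j.
    rewrite leNgt; apply/negP => jM; move/negP: hj; apply.
    apply/mapP; exists (absz (j - 1)); last by move: j1 => /=; lia.
    by rewrite mem_iota; move: j1 => /=; lia.
  rewrite (fsbigE [seq - j%:Z | j <- iota 0 M.+1]); last 3 first.
  - by rewrite map_inj_uniq ?iota_uniq// => j k; lia.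
  - by move=> j /mapP[k _ ->] /=; lia.
  - move=> j j1 hj.
    have [/(_ _)/negbTE->//] := zM j.
    rewrite ltNge; apply/negP => jM; move/negP: hj; apply.
    apply/mapP; exists (absz j); last by move: j1 => /=; lia.
    by rewrite mem_iota; move: j1 => /=; lia.
  have := label_subn 0 M.+1 Oz.
  rewrite (label_low (i := 0 + 1 - _)); last first.
    by move=> j hj; have [+ _] := zM j; apply; lia.
  have := label_addn 1 M Oz.
  rewrite !big_map [in X in X - _]iotaE [in X in _ - X]iotaE.
  rewrite [X in X - _](eq_bigl xpredT) => [|j]; last first.
    by apply: mem_set => /=; lia.
  rewrite [X in _ - X](eq_bigl xpredT) => [|j]; last first.
    by apply: mem_set => /=; lia.
  rewrite !big_mkord.
  rewrite !add0r sumrB sumr_const card_ord -!(big_morph _ PoszD (erefl _)).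
  under [in X in _ -> X -> _]eq_bigr do rewrite add0r.
  by move=> -> ->; rewrite natz add0n addnC PoszD opprD addrA; exact: erefl.
move=> Mi; have [k ->] : exists k : nat, i = 1 + M%:Z + k%:Z.
  by exists (absz (i - 1 - M%:Z)%R); lia.
rewrite label_addn// NM.
rewrite (eq_bigr (fun=> 1%N)).
  by rewrite sum_nat_const card_ord; lia.
by move=> j _; have [_ ->//] := zM (1 + M%:Z + j%:Z)%R; lia.
Qed.

Lemma label_large (z : config) : Omega z ->
  exists M : int, forall i, M <= i -> z i /\ (label z i)%:Z = i - 1 - N z.
Proof.
move=> /OmegaP[M zM]; exists (M%:Z + 1) => i Mi; split.
  by have [_ ->//] := zM i; lia.
have Mi' : M%:Z < i by lia.
by rewrite (N_label zM Mi'); lia.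
Qed.

(** Equality holds far to the right, and going left the label drops by at most one per site. *)
Lemma label_lb (z : config) (i : int) : Omega z ->
  i - 1 - N z <= (label z i)%:Z.
Proof.
move=> Oz; have [M zM] := label_large Oz.
pose k := absz (Num.max M i - i).
have [_ lk] := zM (i + k%:Z) ltac:(lia).
move: lk; rewrite label_addn//.
have : (\sum_(j < k) z (i + j%:Z)%R <= \sum_(j < k) 1)%N.
  by apply: leq_sum => j _; case: (z _).
by rewrite sum_nat_const card_ord muln1; set s := (\sum_(j < k) _)%N; lia.
Qed.

Lemma label_agree (z z' : config) (b : int) : Omega z -> Omega z' ->
  (forall i, b <= i -> z i = z' i) -> label z b = label z' b ->
  forall i, b <= i -> label z i = label z' i.
Proof.
move=> Oz Oz' zz' lb i bi; have [k ->] : exists k : nat, i = b + k%:Z.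
  by exists (absz (i - b)); lia.
rewrite !label_addn// lb; congr (_ + _)%N; apply: eq_bigr => j _.
by rewrite zz'//; lia.
Qed.

(** [N] can be read off from labels far to the right, so a change left of [b] that keeps the number
    of particles there keeps [N]. *)
Lemma N_agree (z z' : config) (b : int) : Omega z -> Omega z' ->
  (forall i, b <= i -> z i = z' i) -> label z b = label z' b -> N z = N z'.
Proof.
move=> Oz Oz' zz' lb.
have [M zM] := label_large Oz; have [M' zM'] := label_large Oz'.
pose i := Num.max b (Num.max M M').
have [_ h] := zM i ltac:(lia); have [_ h'] := zM' i ltac:(lia).
have := label_agree Oz Oz' zz' lb (i := i) ltac:(lia).
by lia.
Qed.

(** One criterion for all the moves below: exchanges leave both tails in place, while pushing and
    pulling translate the left one. *)
Lemma Omega_tails (z z' : config) (s s' a b : int) : Omega z ->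
  (forall i, i < a -> z' i = z (i + s)) ->
  (forall i, b <= i -> z' i = z (i + s')) -> Omega z'.
Proof.
move=> /OmegaP[M zM] za zb; apply/OmegaP.
exists (M + absz s + absz s' + absz a + absz b)%N => i; split => hi.
  by rewrite za; [have [+ _] := zM (i + s); apply|]; lia.
by rewrite zb; [have [_] := zM (i + s'); apply|]; lia.
Qed.

Lemma exchangeL (z : config) (i : int) : exchange z i i = z (i + 1).
Proof. by rewrite /exchange eqxx. Qed.

Lemma exchangeR (z : config) (i : int) : exchange z i (i + 1) = z i.
Proof. by rewrite /exchange eqxx ifN//; lia. Qed.

Lemma exchange_out (z : config) (i j : int) :
  j != i -> j != i + 1 -> exchange z i j = z j.
Proof. by rewrite /exchange => /negbTE -> /negbTE ->. Qed.

Lemma exchangeK (z : config) (i : int) : exchange (exchange z i) i = z.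
Proof.
apply/funext => j; have [->|ji] := eqVneq j i.
  by rewrite exchangeL exchangeR.
have [->|ji1] := eqVneq j (i + 1); first by rewrite exchangeR exchangeL.
by rewrite !exchange_out.
Qed.

(** Hence at most one site contributes to the sum defining [asep_rate] when the exchange really
    changes [z]. *)
Lemma exchange_inj (z : config) (i j : int) : z i != z (i + 1) ->
  exchange z i = exchange z j -> i = j.
Proof.
move=> zi eij; have hi : exchange z j i = z (i + 1) by rewrite -eij exchangeL.
have hi1 : exchange z j (i + 1) = z i by rewrite -eij exchangeR.
have [//|ij] := eqVneq i j; have [ij1|ij1] := eqVneq i (j + 1).
  rewrite exchange_out in hi1; [|lia|lia].
  by rewrite hi1 eqxx in zi.
by rewrite exchange_out// in hi; rewrite hi eqxx in zi.
Qed.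

Lemma Omega_exchange (z : config) (i : int) : Omega z -> Omega (exchange z i).
Proof.
move=> Oz; apply: (@Omega_tails z _ 0 0 i (i + 2)) => // j hj;
  by rewrite addr0 exchange_out//; lia.
Qed.

Lemma label_exchange (z : config) (i j : int) : Omega z -> j != i + 1 ->
  label (exchange z i) j = label z j.
Proof.
move=> Oz ji; have Oe := Omega_exchange i Oz.
have lo k : k <= i -> label (exchange z i) k = label z k.
  by move=> ki; apply: eq_label => l lk; rewrite exchange_out//; lia.
have [ji'|ji'] := leP j i; first exact: lo.
apply: (label_agree (b := i + 1 + 1)) => // [k hk||]; last by lia.
  by rewrite exchange_out//; lia.
by rewrite !label_succ// lo// exchangeL exchangeR addnAC.
Qed.

Lemma label_exchangeS (z : config) (i : int) : Omega z ->
  label (exchange z i) (i + 1) = (label z i + z (i + 1)%R)%N.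
Proof.
move=> Oz; rewrite label_succ; last exact: Omega_exchange.
by rewrite exchangeL label_exchange//; lia.
Qed.

Lemma N_exchange (z : config) (i : int) : Omega z -> N (exchange z i) = N z.
Proof.
move=> Oz; apply: (@N_agree _ _ (i + 2)) => //; first exact: Omega_exchange.
  by move=> j hj; rewrite exchange_out//; lia.
by rewrite label_exchange//; lia.
Qed.

(** A bijection onto the configurations that are empty at [m - 1], with inverse [pull_right]; it
    preserves [N] and the label at [m]. *)
Definition push_left (z : config) (m : int) : config :=
  fun j => if j < m - 1 then z (j + 1) else if j < m then false else z j.

Definition pull_right (z : config) (m : int) : config :=
  fun j => if j < m then z (j - 1) else z j.

Lemma push_leftK (z : config) (m : int) : pull_right (push_left z m) m = z.
Proof.
apply/funext => j; rewrite /pull_right /push_left; case: ltP => jm.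
  by rewrite ifT ?subrK//; lia.
by rewrite !ifN//; lia.
Qed.

Lemma pull_rightK (z : config) (m : int) :
  ~~ z (m - 1) -> push_left (pull_right z m) m = z.
Proof.
move=> zm; apply/funext => j; rewrite /pull_right /push_left; case: ltP => jm.
  by rewrite ifT ?addrK//; lia.
case: ltP => // jm'; have -> : j = m - 1 by lia.
exact/esym/negbTE.
Qed.

Lemma Omega_push_left (z : config) (m : int) : Omega z -> Omega (push_left z m).
Proof.
move=> Oz; apply: (@Omega_tails z _ 1 0 (m - 1) m) => // j hj.
  by rewrite /push_left hj.
by rewrite /push_left addr0 !ifN//; lia.
Qed.

Lemma Omega_pull_right (z : config) (m : int) :
  Omega z -> Omega (pull_right z m).
Proof.
move=> Oz; apply: (@Omega_tails z _ (-1) 0 m m) => // j hj.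
  by rewrite /pull_right hj.
by rewrite /pull_right addr0 !ifN//; lia.
Qed.

Lemma label_push_left_lt (z : config) (m j : int) : Omega z -> j < m ->
  label (push_left z m) j = label z (j + 1).
Proof.
move=> Oz jm; have Op := Omega_push_left m Oz.
have /OmegaP[M zM] := Oz.
(* The site [a] lies so far left that both labels vanish there; from it on, the two counts run over
   the same occupation values. *)
have [a [k [aM am jE]]] : exists a, exists k : nat,
    [/\ a < - M%:Z, a < m - 1 & j = a + k%:Z].
  pose a : int := - M%:Z - (absz m)%:Z - (absz j)%:Z - 2.
  by exists a, (absz (j - a)); rewrite /a; split; lia.
rewrite jE addrAC label_addn// (label_addn (a + 1))//.
rewrite (label_low (z := push_left z m) (i := a)) => [|l la]; last first.
  rewrite /push_left ifT; last by lia.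
  by have [+ _] := zM (l + 1); apply; lia.
rewrite (label_low (z := z) (i := a + 1)) => [|l la]; last first.
  by have [+ _] := zM l; apply; lia.
congr (_ + _)%N; apply: eq_bigr => i _; rewrite /push_left ifT.
  by rewrite addrAC.
by have := ltn_ord i; lia.
Qed.

Lemma label_push_left (z : config) (m : int) : Omega z ->
  label (push_left z m) m = label z m.
Proof.
move=> Oz; have Op := Omega_push_left m Oz.
rewrite -{2}[m](subrK 1) label_succ// label_push_left_lt ?subrK//; last by lia.
by rewrite /push_left ltxx ifT ?addn0//; lia.
Qed.

Lemma N_push_left (z : config) (m : int) : Omega z -> N (push_left z m) = N z.
Proof.
move=> Oz; apply: (@N_agree _ _ m) => //; first exact: Omega_push_left.
  by move=> j hj; rewrite /push_left !ifN//; lia.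
exact: label_push_left.
Qed.

Lemma label_lt (z : config) (i j : int) : Omega z -> z i -> i < j ->
  (label z i < label z j)%N.
Proof.
move=> Oz zi ij; apply: (@leq_trans (label z (i + 1))).
  by rewrite label_succ// zi addn1.
by apply: label_le => //; lia.
Qed.

(** Uniqueness holds because labels increase strictly along particles. For existence, take the first
    site with more than [k] particles to its left: the site just before it is occupied and has label
    [k]. So the default value in [position] never matters on [Omega]. *)
Lemma positionP (z : config) (k : nat) (m : int) : Omega z ->
  position z k = m <-> z m /\ label z m = k.
Proof.
move=> Oz.
have uniq i j : z i /\ label z i = k -> z j /\ label z j = k -> i = j.
  move=> [zi li] [zj lj].
  by have [ij|ij|//] := ltgtP i j; have := label_lt Oz _ ij; rewrite li lj ltnn;
    move=> /(_ ltac:(assumption)).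
have [m' hm'] : exists m', z m' /\ label z m' = k.
  have /OmegaP[M zM] := Oz.
  have ext : exists t : nat, (k < label z (- M%:Z + t%:Z))%N.
    have [M' zM'] := label_large Oz.
    pose i := Num.max M' (Num.max (- M%:Z) (k%:Z + 2 + N z)).
    exists (absz (i + M%:Z)).
    have -> : - M%:Z + (absz (i + M%:Z)%R)%:Z = i by rewrite /i; lia.
    by have [_] := zM' i ltac:(rewrite /i; lia); rewrite /i; lia.
  case: (ex_minnP ext) => -[|t] ht mint.
    move: ht; rewrite addr0 label_low// => j hj.
    by have [+ _] := zM j; apply.
  have {}lt : (label z (- M%:Z + t%:Z)%R <= k)%N.
    by rewrite leqNgt; apply/negP => /mint; rewrite ltnn.
  exists (- M%:Z + t%:Z); move: ht.
  rewrite (_ : - M%:Z + t.+1%:Z = - M%:Z + t%:Z + 1); last by lia.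
  by rewrite label_succ//; case: (z _) => /=; lia.
have pm' : position z k = m'.
  by apply: xget_unique => // j hj; exact: uniq.
by split => [<-|hm]; [rewrite pm'|rewrite pm'; exact: uniq].
Qed.

(** The only configuration of [Omega] with [N = n] in which no particle is followed by a hole, by
    [N_step] and [nondecreasing_step]. *)
Definition step (n : int) : config := fun i => n + 1 <= i.

Lemma Omega_step (n : int) : Omega (step n).
Proof.
by apply/OmegaP; exists (absz n).+1 => i; rewrite /step; split; lia.
Qed.

Lemma label_step (n : int) (k : nat) : label (step n) (n + 1 + k%:Z) = k.
Proof.
rewrite label_addn; last exact: Omega_step.
rewrite label_low => [|j]; last by rewrite /step; lia.
rewrite (eq_bigr (fun=> 1%N)); first by rewrite sum_nat_const card_ord; lia.
by move=> j _; rewrite /step; lia.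
Qed.

Lemma position_step (n : int) (k : nat) : position (step n) k = n + 1 + k%:Z.
Proof.
apply/positionP; first exact: Omega_step.
by rewrite label_step /step; split => //; lia.
Qed.

(** * Weights of single configurations *)

Lemma measurable_coordinate (i : int) (b : bool) :
  measurable ([set z | z i = b] : set mconfig).
Proof. by apply: sub_sigma_algebra; exists i, b. Qed.

Definition cylinder (s : seq int) (z : config) : set mconfig :=
  [set z' : config | forall i, i \in s -> z' i = z i].

Lemma measurable_cylinder (s : seq int) (z : config) :
  measurable (cylinder s z).
Proof.
elim: s => [|i s IH].
  by rewrite (_ : cylinder _ _ = setT)//; apply/seteqP; split.
rewrite (_ : cylinder _ _ = [set z' | z' i = z i] `&` cylinder s z).
  by apply: measurableI => //; exact: measurable_coordinate.
apply/seteqP; split => z' /=.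
  by move=> h; split=> [|j js]; apply: h; rewrite inE ?eqxx ?js ?orbT.
by move=> [hi hs] j; rewrite inE => /predU1P[->//|/hs].
Qed.

Definition exhausting (S : nat -> seq int) : Prop :=
  (forall M i, (absz i <= M)%N -> i \in S M) /\
  (forall M i, i \in S M -> i \in S M.+1).

Lemma bigcap_cylinder (S : nat -> seq int) (z : config) : exhausting S ->
  \bigcap_M cylinder (S M) z = [set z].
Proof.
move=> [Sall _]; apply/seteqP; split => [z' hz'|z' -> M _ //].
by apply/funext => i; apply: (hz' (absz i)) => //; exact: Sall.
Qed.

(** The site [i] comes first, so that its factor splits off the product over the window; the filter
    prevents it from appearing twice. *)
Definition sites (i : int) (M : nat) : seq int :=
  i :: [seq j <- [seq - M%:Z + k%:Z | k <- iota 0 (2 * M).+1] | j != i].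

Lemma sites_uniq (i : int) (M : nat) : uniq (sites i M).
Proof.
rewrite /sites cons_uniq mem_filter eqxx; apply/andP; split=> //.
apply: filter_uniq.
by rewrite map_inj_uniq ?iota_uniq// => j k; lia.
Qed.

Lemma sites_exhausting (i : int) : exhausting (sites i).
Proof.
have sitesP M j : (j \in sites i M) = (j == i) || (absz j <= M)%N.
  rewrite inE mem_filter; case: eqVneq => // _; rewrite !orFb /negb andTb.
  apply/mapP/idP => [[k]|jM]; first by rewrite mem_iota; lia.
  by exists (absz (j + M%:Z)); rewrite ?mem_iota; lia.
split=> M j; rewrite !sitesP; first by move=> ->; rewrite orbT.
by case/orP => [->//|jM]; rewrite (leqW jM) orbT.
Qed.

Lemma measurable_config1 (z : config) : measurable ([set z] : set mconfig).
Proof.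
rewrite -(bigcap_cylinder z (sites_exhausting 0)).
by apply: bigcapT_measurable => M; exact: measurable_cylinder.
Qed.

(** The product formula covers finitely many sites only; continuity from above carries its
    consequences over to single configurations. *)
Lemma cvg_mu_cylinder (R : realType) (mu : probability mconfig R)
    (S : nat -> seq int) (z : config) : exhausting S ->
  fine (mu (cylinder (S M) z)) @[M --> \oo] --> fine (mu [set z]).
Proof.
move=> Sx; apply: fine_cvg; rewrite fineK ?fin_num_measure//; last first.
  exact: measurable_config1.
rewrite -(bigcap_cylinder z Sx).
apply: (nonincreasing_cvg_mu (F := fun M => cylinder (S M) z)).
- rewrite (le_lt_trans (probability_le1 _ _)) ?ltry//.
  exact: measurable_cylinder.
- by move=> M; exact: measurable_cylinder.
- by rewrite bigcap_cylinder//; exact: measurable_config1.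
- apply/nonincreasing_seqP => M; apply/subsetPset => z' hz' i iM.
  by apply: hz'; exact: Sx.2.
Qed.

(** The ratio of the probabilities that site [i] is occupied and that it is empty. *)
Definition odds (R : realType) (q c : R) (i : int) : R := q `^ (c - i%:~R).

Lemma odds_gt0 (R : realType) (q c : R) (i : int) : 0 < q -> 0 < odds q c i.
Proof. exact: powR_gt0. Qed.

Lemma oddsD1 (R : realType) (q c : R) (i : int) : 0 < q ->
  odds q c i = q * odds q c (i + 1).
Proof.
move=> q0; rewrite /odds -{2}[q]powRr1 ?ltW// -powRD; last first.
  by rewrite (gt_eqF q0) implybT.
by congr (_ `^ _); rewrite intrD; lra.
Qed.

(** A configuration of [Omega] is encoded by the finite set [D z] of sites where it differs from
    [step 0]. *)
Lemma countable_Omega : countable Omega.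
Proof.
apply/countable_injP.
pose D (z : config) := [set i : int | z i != (1 <= i)].
exists (fun z => choice.pickle (enum_fset (fset_set (D z)) : seq int)).
move=> z z' /set_mem Oz /set_mem Oz'.
have finD y : Omega y -> finite_set (D y).
  move=> [fl fr]; apply: (@sub_finite_set _ _ ([set i : int | i <= 0 /\ y i] `|`
    [set i : int | 1 <= i /\ ~~ y i])); last by rewrite finite_setU.
  move=> i; rewrite /D /=.
  by case: (y i); case: leP => hi // _; [left|right].
move=> H; have eD := pcan_inj (@choice.pickleK (seq int)) H; apply/funext => i.
have : (i \in fset_set (D z)) = (i \in fset_set (D z')).
  exact: (congr1 (fun s : seq int => i \in s) eD).
have DE y : (i \in D y) = (y i != (1 <= i)) by apply/idP/idP; rewrite inE.
rewrite !in_fset_set ?DE; [|exact: finD|exact: finD].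
by case: (z i); case: (z' i); case: leP.
Qed.

Lemma Omega_sub_measurable (A : set mconfig) : A `<=` Omega -> measurable A.
Proof.
move=> AO; apply: countable_measurable => [z|].
  exact: measurable_config1.
exact: sub_countable (subset_card_le AO) countable_Omega.
Qed.

Lemma measure_Omega_sub (R : realType) (mu : probability mconfig R)
    (A : set config) : A `<=` Omega ->
  (mu A = \esum_(z in A) mu [set z])%E.
Proof.
move=> AO; apply: (measure_countable_preimage mu (f := id)).
  exact: sub_countable (subset_card_le AO) countable_Omega.
by move=> z _; exact: measurable_config1.
Qed.

Section Weight.
Variables (R : realType) (q c : R) (mu : probability mconfig R).
Hypotheses (q0 : 0 < q) (hmu : is_product_measure q c mu).

Lemma prob_true (i : int) :
  fine (mu [set z | z i = true]) = odds q c i / (1 + odds q c i).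
Proof. by rewrite hmu.1. Qed.

Lemma prob_false (i : int) :
  fine (mu [set z | z i = false]) = 1 / (1 + odds q c i).
Proof.
have -> : [set z : mconfig | z i = false] = ~` [set z : mconfig | z i = true].
  by apply/seteqP; split => z /=; [move->|move/negP/negbTE].
rewrite probability_setC; last exact: measurable_coordinate.
rewrite hmu.1 -EFinB /= -/(odds _ _ _).
have := odds_gt0 c i q0; set x := odds q c i => x0.
by field; rewrite gt_eqF// addr_gt0.
Qed.

Lemma prob_coord (i : int) (b : bool) :
  fine (mu [set z | z i = b]) = odds q c i ^+ b / (1 + odds q c i).
Proof. by case: b; rewrite ?prob_true ?prob_false. Qed.

(** On every finite window the two cylinder probabilities differ only in the factor at [i], and this
    relation passes to the limit. The cross-multiplied form remains valid when the weights
    vanish. *)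
Lemma weight_flip (z z' : config) (i : int) :
  (forall j, j != i -> z j = z' j) ->
  fine (mu [set z]) * odds q c i ^+ z' i =
  fine (mu [set z']) * odds q c i ^+ z i.
Proof.
move=> zz'.
pose rest M := \prod_(j <- behead (sites i M)) fine (mu [set y | y j = z j]).
have cylE (y : config) M : (forall j, j != i -> z j = y j) ->
    fine (mu (cylinder (sites i M) y)) =
    odds q c i ^+ y i / (1 + odds q c i) * rest M.
  move=> zy; rewrite hmu.2 ?sites_uniq//.
  have -> : (\prod_(j <- sites i M) mu [set y0 | y0 j = y j] =
      (\prod_(j <- sites i M) fine (mu [set y0 | y0 j = y j]))%:E)%E.
    rewrite -prodEFin; apply: eq_bigr => j _; rewrite fineK//.
    by rewrite fin_num_measure//; exact: measurable_coordinate.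
  rewrite /= big_cons prob_coord /rest; congr (_ * _).
  rewrite [in LHS]big_seq [in RHS]big_seq; apply: eq_bigr => j.
  by rewrite mem_filter => /andP[ji _]; rewrite zy.
have cz := cvg_mu_cylinder (mu := mu) (z := z) (sites_exhausting i).
have cz' := cvg_mu_cylinder (mu := mu) (z := z') (sites_exhausting i).
have h := cvg_lim (@norm_hausdorff _ R)
  (cvgMr_tmp (b := odds q c i ^+ z' i) cz).
have h' := cvg_lim (@norm_hausdorff _ R)
  (cvgMr_tmp (b := odds q c i ^+ z i) cz').
rewrite -h -h'.
by congr (lim (_ @ \oo)); apply/funext => M; rewrite !cylE//; ring.
Qed.

Let w (z : config) : R := fine (mu [set z]).

Lemma weight_window (z z' : config) (a : int) (L : nat) :
  (forall j, j < a \/ a + L%:Z <= j -> z j = z' j) ->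
  w z * \prod_(k < L) odds q c (a + k%:Z) ^+ z' (a + k%:Z) =
  w z' * \prod_(k < L) odds q c (a + k%:Z) ^+ z (a + k%:Z).
Proof.
elim: L z z' => [|L IH] z z' zz'.
  rewrite !big_ord0 (_ : z = z')//; apply/funext => j; apply: zz'.
  by have [] := ltP j a; [left|right]; rewrite ?addr0.
pose b := a + L%:Z.
(* An intermediate configuration: it differs from [z] at most on the first [L] sites, and from [z']
   at most at the last site [b]. *)
pose y : config := fun j => if j == b then z j else z' j.
have zy j : j < a \/ b <= j -> z j = y j.
  rewrite /y; case: eqVneq => // jb hj; apply: zz'; rewrite /b in jb hj; lia.
have yz' j : j != b -> y j = z' j by rewrite /y => /negbTE ->.
have := IH z y zy; have := weight_flip yz'.
have -> : y b = z b by rewrite /y eqxx.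
rewrite !big_ord_recr /= -/b.
rewrite [X in w z * X = _](eq_bigr (fun k : 'I_L =>
    odds q c (a + k%:Z) ^+ z' (a + k%:Z))) => [|k _]; last first.
  by rewrite yz'// /b; have := ltn_ord k; lia.
set A := \prod_(k < L) _; set B := \prod_(k < L) _.
rewrite -!/(w _) => h1 h2.
by rewrite mulrA h2 mulrAC h1; ring.
Qed.

Lemma weight_exchange (z : config) (i : int) : z i -> ~~ z (i + 1) ->
  w z = w (exchange z i) * q.
Proof.
move=> zi zi1; have := @weight_window z (exchange z i) i 2.
rewrite !big_ord_recl !big_ord0 /= !addr0.
rewrite exchangeL exchangeR zi (negbTE zi1) /= !mulr1 expr0 expr1 !mul1r.
rewrite (oddsD1 c i q0) mulrA => h.
apply: (mulIf (lt0r_neq0 (odds_gt0 c (i + 1) q0))); apply: h => j hj.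
by rewrite exchange_out//; lia.
Qed.

Lemma weight_push_left (z : config) (m : int) : Omega z ->
  w (push_left z m) = w z * q ^+ label z m.
Proof.
move=> Oz; have /OmegaP[M zM] := Oz.
have [a [L [aM mE]]] : exists a : int, exists L : nat,
    a < - M%:Z /\ m = a + 1 + L%:Z.
  pose a : int := - M%:Z - (absz m)%:Z - 1.
  by exists a, (absz (m - a - 1)%R); rewrite /a; split; lia.
have low j : j <= a -> z j = false.
  by move=> ja; have [+ _] := zM j; move=> /(_ ltac:(lia))/negbTE.
(* On the window [[a, m)] the first site of [z] and the last site of [push_left z m] are empty. The
   other factors match after a shift by one site, each particle contributing one [q] by [oddsD1]. *)
have := @weight_window (push_left z m) z a L.+1.
rewrite big_ord_recl [X in _ = _ * X]big_ord_recr /= addr0.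
rewrite low// (_ : push_left z m (a + L%:Z) = false); last first.
  by rewrite /push_left ifN ?ifT//; lia.
rewrite !expr0 mul1r mulr1.
have shiftE (k : nat) : a + (bump 0 k)%:Z = a + 1 + k%:Z by rewrite /bump; lia.
under eq_bigr do rewrite shiftE.
rewrite [X in _ = _ * X](eq_bigr (fun k : 'I_L =>
   q ^+ z (a + 1 + k%:Z) * odds q c (a + 1 + k%:Z) ^+ z (a + 1 + k%:Z)));
  last first.
  move=> k _; rewrite /push_left ifT; last by have := ltn_ord k; lia.
  rewrite (addrAC a 1); case: (z _); rewrite ?mulr1// !expr1.
  by rewrite oddsD1.
rewrite big_split/= mulrA => h.
have -> : q ^+ label z m = \prod_(k < L) q ^+ z (a + 1 + k%:Z).
  rewrite mE label_addn// label_low => [|j ja]; last by rewrite low//; lia.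
  by rewrite add0n expr_sum.
have P0 : 0 < \prod_(k < L) odds q c (a + 1 + k%:Z) ^+ z (a + 1 + k%:Z).
  by apply: prodr_gt0 => k _; apply: exprn_gt0; exact: odds_gt0.
apply: (mulIf (lt0r_neq0 P0)); apply: h => j [ja|mj].
  rewrite (low j) ?ltW// /push_left ifT; last by lia.
  by rewrite low//; lia.
by rewrite /push_left !ifN//; lia.
Qed.

(** Two configurations of [Omega] differ at finitely many sites, and all odds are positive. *)
Lemma weight_pos (z z' : config) : Omega z -> Omega z' -> 0 < w z -> 0 < w z'.
Proof.
move=> /OmegaP[M zM] /OmegaP[M' zM'] wz.
have := @weight_window z z' (- (M + M')%:Z) (2 * (M + M')).
set A := \prod_(_ < _) _; set B := \prod_(_ < _) _.
have A0 : 0 < A by apply: prodr_gt0 => k _; apply: exprn_gt0; exact: odds_gt0.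
have B0 : 0 < B by apply: prodr_gt0 => k _; apply: exprn_gt0; exact: odds_gt0.
move=> h; rewrite -(pmulr_lgt0 _ B0) -h ?mulr_gt0// => j [] hj.
  have [+ _] := zM j; have [+ _] := zM' j.
  by move=> /(_ ltac:(lia))/negbTE -> /(_ ltac:(lia))/negbTE ->.
have [_ +] := zM j; have [_ +] := zM' j.
by move=> /(_ ltac:(lia)) -> /(_ ltac:(lia)) ->.
Qed.

End Weight.

(** * Finiteness of the expected number of discrepancies between neighbouring sites *)

Lemma oddsDn (R : realType) (q c : R) (i : int) (k : nat) : 0 < q ->
  odds q c i = q ^+ k * odds q c (i + k%:Z).
Proof.
move=> q0; elim: k => [|k IH]; first by rewrite mul1r addr0.
rewrite (_ : i + k.+1%:Z = i + k%:Z + 1); last by lia.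
by rewrite IH (oddsD1 c (i + k%:Z) q0) exprSr mulrA.
Qed.

Section Crossing.
Variables (R : realType) (q c : R) (mu : probability mconfig R).
Hypotheses (q01 : 0 < q < 1) (hmu : is_product_measure q c mu).

Let q0 : 0 < q. Proof. by case/andP: q01. Qed.
Let q1 : q < 1. Proof. by case/andP: q01. Qed.

Definition discrepancy (i : int) : set config :=
  [set z : config | Omega z /\ z i != z (i + 1)].

(** Of two different neighbours, one has the value [b]. The bound is used with the rare value: a
    hole on the right half-line, a particle on the left. *)
Lemma discrepancy_le (i : int) (b : bool) :
  (mu (discrepancy i) <=
   mu [set z : config | z i = b] + mu [set z : config | z (i + 1)%R = b])%E.
Proof.
apply: le_trans (measureU2 _ _ _); try exact: measurable_coordinate.
apply: le_measure; rewrite ?inE.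
- by apply: Omega_sub_measurable => z [].
- by apply: measurableU; exact: measurable_coordinate.
- have bool2 (x y : bool) : x != y -> x = b \/ y = b.
    by case: x; case: y => //; case: b => _; [left|right|right|left].
  by move=> z [_ /bool2].
Qed.

Lemma discrepancy_geometric : exists2 C : R, 0 <= C & forall k : nat,
  (mu (discrepancy k%:Z) <= (C * q ^+ k)%:E)%E /\
  (mu (discrepancy (Negz k)) <= (C * q ^+ k)%:E)%E.
Proof.
pose x := odds q c 0; have x0 : 0 < x by exact: odds_gt0.
have odds0 i : 0 < odds q c i by exact: odds_gt0.
have coordE (i : int) (b : bool) : mu [set z | z i = b] =
    (odds q c i ^+ b / (1 + odds q c i))%:E.
  rewrite -(prob_coord q0 hmu) fineK// fin_num_measure//.
  exact: measurable_coordinate.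
have hi (k : nat) : (mu [set z : config | z k%:Z = false] <= (q ^+ k / x)%:E)%E.
  rewrite coordE lee_fin expr0 mul1r /x (oddsDn c 0 k q0) add0r invfM mulrA.
  rewrite mulfV ?mul1r ?lt0r_neq0 ?exprn_gt0// lef_pV2 ?posrE ?addr_gt0//.
  by rewrite lerDr.
have lo (k : nat) :
    (mu [set z : config | z (- k%:Z)%R = true] <= (q ^+ k * x)%:E)%E.
  rewrite coordE lee_fin expr1 (oddsDn c (- k%:Z) k q0) addNr -/x.
  have y0 : 0 < q ^+ k * x by rewrite mulr_gt0// exprn_gt0.
  by rewrite ler_pdivrMr ?addr_gt0// ler_peMr ?ltW// ltrDl.
have qS k : q ^+ k.+1 <= q ^+ k by rewrite exprS ler_piMl// ?exprn_ge0// ltW.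
(* Each of the two sites contributes at most [q ^+ k / x] on the right and [q ^+ k * x] on the left;
   one constant serves both sides. *)
exists (2 * (x + x^-1)); first by rewrite mulr_ge0// addr_ge0 ?invr_ge0// ltW.
have qk0 k : 0 < q ^+ k by exact: exprn_gt0.
have xV0 : 0 < x^-1 by rewrite invr_gt0.
move=> k; split.
  apply: le_trans (discrepancy_le _ false) _.
  have hi1 : (mu [set z : config | z (k%:Z + 1)%R = false] <=
      (q ^+ k.+1 / x)%:E)%E.
    by have := hi k.+1; rewrite (_ : k.+1%:Z = k%:Z + 1)//; lia.
  apply: le_trans (leeD (hi k) hi1) _.
  rewrite -EFinD lee_fin; have := qS k; have := qk0 k; nra.
apply: le_trans (discrepancy_le _ true) _.
have lo0 : (mu [set z : config | z (Negz k) = true] <= (q ^+ k.+1 * x)%:E)%E.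
  by have := lo k.+1; rewrite (_ : - k.+1%:Z = Negz k).
have lo1 : (mu [set z : config | z (Negz k + 1)%R = true] <= (q ^+ k * x)%:E)%E.
  by have := lo k; rewrite (_ : - k%:Z = Negz k + 1)//; lia.
apply: le_trans (leeD lo0 lo1) _.
rewrite -EFinD lee_fin; have := qS k; have := qk0 k; nra.
Qed.

Lemma weight_discrepancy_sum :
  (\esum_(z in Omega) \esum_(i in [set: int])
    (fine (mu [set z]) * (z i != z (i + 1))%:R)%:E < +oo)%E.
Proof.
rewrite esum_exchange => [|z i]; last by rewrite lee_fin mulr_ge0// fine_ge0.
rewrite (eq_esum (b := fun i => mu (discrepancy i))) => [|i _]; last first.
  rewrite (measure_Omega_sub mu (A := discrepancy i)) => [|z []//].
  rewrite (_ : discrepancy i = Omega `&` [set z | z i != z (i + 1)])//.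
  rewrite [RHS]esum_mkcondr; apply: eq_esum => z _.
  have -> : (z \in [set z | z i != z (i + 1)]) = (z i != z (i + 1)).
    by apply/idP/idP; rewrite inE.
  case: ifPn => _; last by rewrite mulr0.
  by rewrite mulr1 fineK// fin_num_measure//; exact: measurable_config1.
have [C C0 hC] := discrepancy_geometric.
rewrite esum_int//.
have fin : (\esum_(k in [set: nat]) (C * q ^+ k)%:E < +oo)%E.
  under eq_esum do rewrite EFinM.
  rewrite ge0_esumZl//; last by move=> k; rewrite lee_fin exprn_ge0// ltW.
  by rewrite esum_geometric ?q1 ?ltW// -EFinM ltry.
apply: lte_add_pinfty; apply: le_lt_trans fin; apply: le_esum => k _.
  exact: (hC k).1.
exact: (hC k).2.
Qed.

End Crossing.

(** * Rates of the coupled system *)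

Section Rates.
Variables (R : realType) (q : R).
Hypothesis q01 : 0 < q < 1.

Let q0 : 0 < q. Proof. by case/andP: q01. Qed.
Let q1 : q < 1. Proof. by case/andP: q01. Qed.

Lemma asep_rate_exchange (z : config) (i : int) : z i != z (i + 1) ->
  asep_rate q z (exchange z i) = if z i then 1 else q.
Proof.
move=> zi; rewrite /asep_rate (fsbigE [:: i])//=; last first.
  move=> j _; rewrite inE => ji; case: eqP => // eij.
  by move: ji; rewrite (exchange_inj zi eij) eqxx.
rewrite big_mkcond big_seq1 mem_set// eqxx.
by case: (z i) zi; case: (z (i + 1)).
Qed.

Lemma asep_rate_eq0 (z z' : config) :
  (forall i, z i != z (i + 1) -> z' != exchange z i) -> asep_rate q z z' = 0.
Proof.
move=> h; rewrite /asep_rate fsbig1// => i _; case: ifPn => // ez.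
by have := h i; rewrite ez; case: (z i); case: (z (i + 1)) => //= /(_ isT).
Qed.

(** The alternative is symmetric in [z] and [z'] because an exchange is an involution, so a jump and
    its reverse are treated together. *)
Lemma asep_rateP (z z' : config) :
  (exists i, z i != z (i + 1) /\ z' = exchange z i) \/
  (asep_rate q z z' = 0 /\ asep_rate q z' z = 0).
Proof.
have [|h] := pselect (exists i, z i != z (i + 1) /\ z' = exchange z i).
  by left.
right; split; apply: asep_rate_eq0 => i zi; apply/eqP => e; apply: h.
  by exists i.
exists i; rewrite e exchangeK exchangeL exchangeR; split => //.
by rewrite eq_sym.
Qed.

Lemma asep_rate_ge0 (z z' : config) : 0 <= asep_rate q z z'.
Proof.
have [[i [zi ->]]|[-> _]//] := asep_rateP z z'.
by rewrite asep_rate_exchange//; case: (z i) => //; exact: ltW.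
Qed.

Lemma asep_rate_le (z z' : config) : ((asep_rate q z z')%:E <=
  \esum_(i in [set: int])
    ((z' == exchange z i) && (z i != z (i + 1)))%:R%:E)%E.
Proof.
have [[i [zi ->]]|[-> _]] := asep_rateP z z'; last first.
  by apply: esum_ge0 => i _; rewrite lee_fin.
apply: esum_ge; exists [set i]; first by split.
rewrite fsbig_set1 eqxx zi asep_rate_exchange// lee_fin.
by case: (z i) => //; exact: ltW.
Qed.

Lemma asep_rate_diag (z : config) : asep_rate q z z = 0.
Proof.
apply: asep_rate_eq0 => i zi; apply/eqP => e; move: zi.
by rewrite [X in X i != _]e exchangeL eqxx.
Qed.

Lemma label_rate_ge0 (z : config) (k l : nat) : 0 <= label_rate q z k l.
Proof. by rewrite /label_rate; repeat case: ifP => // _; exact: ltW. Qed.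

Lemma label_rate_le (z : config) (k l : nat) :
  label_rate q z k l <= (l == k.+1)%:R + (k == l.+1)%:R.
Proof.
rewrite /label_rate; case: ifP => _; last by rewrite addr_ge0.
by case: ifP => _; [rewrite ler_wpDr// ltW|case: ifP => _; rewrite add0r].
Qed.

Lemma coupled_rate_ge0 (a b : state) : 0 <= coupled_rate q a b.
Proof.
rewrite /coupled_rate addr_ge0//; case: ifP => // _.
  exact: asep_rate_ge0.
exact: label_rate_ge0.
Qed.

Lemma coupled_rate_diag (a : state) : coupled_rate q a a = 0.
Proof.
rewrite /coupled_rate !eqxx asep_rate_diag add0r /label_rate.
by rewrite /neighbours subrr normr0.
Qed.

Lemma val_Omega_inj (z z' : Omega) : val z = val z' -> z = z'.
Proof. exact: val_inj. Qed.

(** Each discrepancy allows one exchange, at rate at most 1, and the label has at most two moves.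
    Every indicator in [coupled_le] holds for at most one target state. *)
Lemma coupled_rate_sum_le (a : state) :
  (\esum_(b in [set: state]) (coupled_rate q a b)%:E <=
   \esum_(i in [set: int]) (val a.1 i != val a.1 (i + 1)%R)%:R%:E + 2%:E)%E.
Proof.
have coupled_le b : ((coupled_rate q a b)%:E <=
    \esum_(i in [set: int]) [&& a.2 == b.2, val b.1 == exchange (val a.1) i &
      val a.1 i != val a.1 (i + 1)%R]%:R%:E +
    ((b == (a.1, a.2.+1))%:R%:E + ((a.1, a.2) == (b.1, b.2.+1))%:R%:E))%E.
  rewrite /coupled_rate EFinD leeD//.
    case: ifP => _ /=; first exact: asep_rate_le.
    by rewrite esum1.
  rewrite -EFinD lee_fin; case: b => z y /=; rewrite !xpair_eqE.
  have [->|az] := eqVneq a.1 z; last by rewrite addr_ge0.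
  exact: label_rate_le.
apply: (le_trans (le_esum (fun b _ => coupled_le b))).
rewrite !esumD => //; last 2 first.
- by move=> b _; apply: esum_ge0 => i _; rewrite lee_fin.
- by move=> b _; rewrite adde_ge0// lee_fin.
apply: leeD.
  rewrite esum_exchange => [|b i]; last by rewrite lee_fin.
  apply: le_esum => i _; case: (val a.1 i != _) => /=; last first.
    by rewrite esum1// => b _; rewrite !andbF.
  apply: esum_indic_le1 => b b' /and3P[/eqP a2 /eqP b1 _].
  move=> /and3P[/eqP a2' /eqP b1' _].
  case: b b' a2 b1 a2' b1' => [z y] [z' y'] /= <- e <- e'.
  congr (_, _); apply: val_Omega_inj; exact: etrans e (esym e').
rewrite (_ : 2%:E = 1 + 1)%E; last by rewrite -EFinD.
apply: leeD; apply: esum_indic_le1 => b b' /eqP + /eqP.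
  by move=> -> ->.
by case: b b' => [z y] [z' y'] [<- ->] [<- [->]].
Qed.

End Rates.

Lemma esum_state (R : realType) (F : config -> nat -> \bar R) :
  (forall z x, (0 <= F z x)%E) ->
  (\esum_(s in [set: state]) F (val s.1) s.2 =
   \esum_(z in Omega) \esum_(x in [set: nat]) F z x)%E.
Proof.
move=> F0; rewrite esum_esum//.
rewrite (@reindex_esum _ _ _ [set: state] (Omega `*`` (fun=> [set: nat]))
  (fun s : state => (val s.1, s.2)))//.
split => //=.
- by move=> [z x] _ /=; split => //; exact: set_valP.
- by move=> [z x] [z' x'] _ _ /= [/val_Omega_inj -> ->].
- by move=> [z x] [/= Oz _]; exists (SigSub (mem_set Oz), x).
Qed.

Lemma countable_state : countable [set: state].
Proof.
have /countable_injP[f injf] := countable_Omega.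
apply/countable_injP.
exists (fun s : state => choice.pickle (f (val s.1), s.2)).
move=> [z x] [z' x'] _ _.
move=> /(pcan_inj (@choice.pickleK (nat * nat)%type)) /= [fz ->].
congr (_, _); apply: val_Omega_inj; apply: injf => //; apply: mem_set;
  exact: set_valP.
Qed.

(** * Reversibility and total flux of the coupled system *)

Section Invariant.
Variables (R : realType) (q c : R) (mu : probability mconfig R).
Hypotheses (q01 : 0 < q < 1) (hmu : is_product_measure q c mu).

Let q0 : 0 < q. Proof. by case/andP: q01. Qed.
Let q1 : q < 1. Proof. by case/andP: q01. Qed.

(** The weight is not conditioned on [N]: jumps preserve [N], so one positive weight on all states
    serves every level. *)
Definition state_weight (s : state) : R :=
  fine (mu [set val s.1]) * q ^+ s.2.

Lemma weight_asep_balance (z z' : config) :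
  fine (mu [set z]) * asep_rate q z z' = fine (mu [set z']) * asep_rate q z' z.
Proof.
have [[i [zi ->]]|[-> ->]] := asep_rateP q z z'; last by rewrite !mulr0.
have ei : exchange z i i != exchange z i (i + 1).
  by rewrite exchangeL exchangeR eq_sym.
rewrite asep_rate_exchange//.
have := asep_rate_exchange q ei; rewrite exchangeK => ->.
rewrite exchangeL.
case: (boolP (z i)) zi => zi; case: (boolP (z (i + 1))) => zi1//.
  by rewrite mulr1 (weight_exchange q0 hmu zi zi1).
move=> _; rewrite mulr1 (weight_exchange q0 hmu (z := exchange z i) (i := i)).
- by rewrite exchangeK.
- by rewrite exchangeL.
- by rewrite exchangeR.
Qed.

(** Exchanges balance by [weight_asep_balance]; label moves balance since going up at rate [q] and
    down at rate 1 matches the factor [q ^+ x]. *)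
Lemma state_weight_balance (a b : state) :
  state_weight a * coupled_rate q a b = state_weight b * coupled_rate q b a.
Proof.
case: a b => [z x] [z' x']; rewrite /state_weight /coupled_rate /= !mulrDr.
congr (_ + _).
  rewrite [x' == x]eq_sym; case: eqVneq => [->|_]; last by rewrite !mulr0.
  by rewrite mulrAC weight_asep_balance mulrAC.
rewrite [z' == z]eq_sym; case: eqVneq => [->|_]; last by rewrite !mulr0.
rewrite -!mulrA; congr (_ * _).
rewrite /label_rate {2}/neighbours distrC -/(neighbours _ _ _).
case: ifP => _; last by rewrite !mulr0.
case: eqVneq => [->|_].
  by rewrite ifN ?eqxx ?mulr1 ?exprSr//; lia.
case: eqVneq => [->|_]; last by rewrite !mulr0.
by rewrite mulr1 exprSr.
Qed.

(** The exit rate is at most the number of discrepancies plus 2, which has finite expectation under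
    [mu] restricted to [Omega]; the labels add a geometric series. *)
Lemma state_weight_rate_sum :
  (\esum_(a in [set: state]) \esum_(b in [set: state])
     (state_weight a * coupled_rate q a b)%:E < +oo)%E.
Proof.
pose w (z : config) := fine (mu [set z]).
have w0 z : 0 <= w z by exact: fine_ge0.
pose X (z : config) : \bar R :=
  (\esum_(i in [set: int]) (z i != z (i + 1)%R)%:R%:E)%E.
have X0 z : (0 <= X z)%E by apply: esum_ge0 => i _; rewrite lee_fin.
pose Y z : \bar R := ((w z)%:E * (X z + 2%:E))%E.
have Y0 z : (0 <= Y z)%E by rewrite mule_ge0 ?lee_fin ?adde_ge0.
have finY : (\esum_(z in Omega) Y z < +oo)%E.
  rewrite /Y (eq_esum (b := fun z => \esum_(i in [set: int])
      (w z * (z i != z (i + 1)%R)%:R)%:E + 2%:E * (w z)%:E)%E); last first.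
    move=> z _; rewrite ge0_muleDr ?lee_fin//.
    by rewrite [X in (_ + X = _)%E]muleC /X -ge0_esumZl.
  rewrite esumD => [|z _|z _]; last 2 first.
  - by apply: esum_ge0 => i _; rewrite lee_fin mulr_ge0.
  - by rewrite -EFinM lee_fin mulr_ge0.
  apply: lte_add_pinfty; first exact: weight_discrepancy_sum q01 hmu.
  rewrite ge0_esumZl => [|//|z]; last by rewrite lee_fin.
  rewrite (eq_esum (b := fun z => mu [set z])) => [|z _]; last first.
    by rewrite /w fineK// fin_num_measure//; exact: measurable_config1.
  have <- : (mu Omega = \esum_(z in Omega) mu [set z])%E.
    exact: measure_Omega_sub.
  rewrite lte_mul_pinfty//.
  apply: le_lt_trans (probability_le1 _ _) (ltry _).
  exact: Omega_sub_measurable.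
apply: (@le_lt_trans _ _ (\esum_(a in [set: state])
    ((q ^+ a.2)%:E * Y (val a.1)))%E).
  apply: le_esum => a _; under eq_esum do rewrite EFinM.
  rewrite ge0_esumZl; last 2 first.
  - by apply: mulr_ge0; [exact: w0|rewrite exprn_ge0// ltW].
  - by move=> b; rewrite lee_fin coupled_rate_ge0.
  rewrite /state_weight [in leLHS]mulrC EFinM -muleA lee_wpmul2l//.
    by rewrite lee_fin exprn_ge0// ltW.
  apply: lee_wpmul2l; first by rewrite lee_fin; exact: w0.
  exact: coupled_rate_sum_le.
rewrite (esum_state (F := fun z x => ((q ^+ x)%:E * Y z)%E)); last first.
  by move=> z x; rewrite mule_ge0 ?lee_fin ?exprn_ge0// ltW.
rewrite esum_exchange => [|z x]; last first.
  by rewrite mule_ge0 ?lee_fin ?exprn_ge0// ltW.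
rewrite (eq_esum (b := fun x => ((fine (\esum_(z in Omega) Y z))%:E *
    (q ^+ x)%:E)%E)) => [|x _]; last first.
  rewrite ge0_esumZl ?exprn_ge0 ?ltW// muleC fineK//.
  by rewrite ge0_fin_numE// esum_ge0.
rewrite ge0_esumZl; last 2 first.
- by rewrite fine_ge0// esum_ge0.
- by move=> x; rewrite lee_fin exprn_ge0// ltW.
by rewrite esum_geometric ?q1 ?ltW// -EFinM ltry.
Qed.

End Invariant.

(** * Connecting a configuration to the step configuration *)

Lemma nondecreasing_step (z : config) (n : int) : Omega z -> N z = n ->
  (forall i, z i -> z (i + 1)) -> z = step n.
Proof.
move=> Oz Nz up.
have upn i (k : nat) : z i -> z (i + k%:Z).
  move=> zi; elim: k => [|k IH]; first by rewrite addr0.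
  by rewrite (_ : i + k.+1%:Z = i + k%:Z + 1); [exact: up|lia].
have [M zM] := label_large Oz.
apply/funext => i; rewrite /step; case: (boolP (z i)) => zi.
  (* From an occupied [i] on, all sites are occupied, so the label of [i] is [i - 1 - n], and it is
     nonnegative. *)
  pose k := absz (Num.max M i - i).
  have [_] := zM (i + k%:Z) ltac:(lia); rewrite label_addn//.
  rewrite (eq_bigr (fun=> 1%N)) => [|j _]; last by rewrite upn.
  by rewrite sum_nat_const card_ord Nz; lia.
have low j : j <= i -> ~~ z j.
  move=> ji; apply: contra zi => zj.
  by have := upn j (absz (i - j)) zj; rewrite (_ : j + _ = i)//; lia.
have := label_lb (i + 1) Oz.
rewrite label_low; last by move=> j hj; apply: low; lia.
by rewrite Nz; lia.
Qed.

(* An exchange 10 -> 01 at [i] lowers [label z (i + 1)] by one and changes no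
   other label. *)
Lemma exchange_connected (T : Type) (n : int) (f : config -> T) :
  (forall z i, Omega z -> N z = n -> z i -> ~~ z (i + 1) ->
     f z = f (exchange z i)) ->
  forall z, Omega z -> N z = n -> f z = f (step n).
Proof.
move=> fe z Oz; have /OmegaP[M zM] := Oz.
(* The induction runs on the sum of the labels over [[-M, M]]. Exchanges of a particle with a hole
   stay inside the window, so [M] remains fixed. *)
pose E (y : config) := (\sum_(k < (2 * M).+1) label y (- M%:Z + k%:Z)%R)%N.
move: {2}(E z).+1 (ltnSn (E z)) => e.
elim: e z Oz zM => // e IH z Oz zM Ez Nz.
have [[i [zi zi1]]|desc] := pselect (exists i, z i /\ ~~ z (i + 1)); last first.
  rewrite (_ : z = step n)//; apply: nondecreasing_step => // i zi.
  by apply/negPn/negP => zi1; apply: desc; exists i.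
have iM := window_ge zM zi; have i1M := window_lt zM zi1.
rewrite (fe z i)//; apply: IH.
- exact: Omega_exchange.
- move=> j; have [jlo jhi] := zM j; split => hj.
    by rewrite exchange_out; [exact: jlo|lia|lia].
  by rewrite exchange_out; [exact: jhi|lia|lia].
- rewrite -ltnS; apply: leq_trans Ez; rewrite ltnS.
  have lei k : (label (exchange z i) k <= label z k)%N.
    have [->|ki] := eqVneq k (i + 1); last by rewrite label_exchange.
    by rewrite label_exchangeS// label_succ// zi (negbTE zi1) leq_add2l.
  have hk : (absz (i + 1 + M%:Z)%R < (2 * M).+1)%N by lia.
  rewrite /E (bigD1 (Ordinal hk))//= [ltnRHS](bigD1 (Ordinal hk))//=.
  rewrite (_ : - M%:Z + _ = i + 1); last by lia.
  rewrite -addSn leq_add//; last by apply: leq_sum => k _; exact: lei.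
  by rewrite label_exchangeS// label_succ// zi (negbTE zi1) addn1 addn0.
- by rewrite N_exchange.
Qed.

(** * The law of the position of a labelled particle *)

Section Cut.
Variables (R : realType) (q c : R) (mu : probability mconfig R) (n : int).
Hypotheses (q01 : 0 < q < 1) (hmu : is_product_measure q c mu).

Let q0 : 0 < q. Proof. by case/andP: q01. Qed.
Let q1 : q < 1. Proof. by case/andP: q01. Qed.

Definition level : set config := [set z : config | Omega z /\ N z = n].

Hypothesis mu_level : 0 < fine (mu level).

(* On subsets of [Omega] everything is measurable, so this is [nu^n(A)]. *)
Definition nu (A : set config) : R :=
  fine (mu (A `&` level)) / fine (mu level).

Lemma level_sub_measurable (A : set config) :
  measurable (A `&` level : set mconfig).
Proof. by apply: Omega_sub_measurable => z [_ []]. Qed.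

Lemma nu_ge0 (A : set config) : 0 <= nu A.
Proof. by rewrite divr_ge0 ?fine_ge0. Qed.

Lemma nu_le (A B : set config) :
  A `&` level `<=` B -> nu A <= nu B.
Proof.
move=> AB; rewrite ler_pM2r ?invr_gt0// fine_le ?fin_num_measure//;
  try exact: level_sub_measurable.
apply: le_measure; rewrite ?inE; try exact: level_sub_measurable.
by move=> z Az; split; [exact: AB|exact: Az.2].
Qed.

Lemma eq_nu (A B : set config) :
  (forall z, Omega z -> N z = n -> A z <-> B z) -> nu A = nu B.
Proof.
by move=> AB; apply/eqP; rewrite eq_le !nu_le// => z [Az [Oz Nz]]; apply/AB.
Qed.

Lemma nu_setID (B A : set config) : nu A = nu (A `&` B) + nu (A `&` ~` B).
Proof.
rewrite /nu -mulrDl; congr (_ / _).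
rewrite -fineD ?fin_num_measure//; try exact: level_sub_measurable.
rewrite -measureU; try exact: level_sub_measurable.
  by rewrite -setIUl -setIUr setUCr setIT.
by rewrite setIACA [A `&` B `&` _]setIACA setICr setI0 set0I.
Qed.

Lemma nu_setT : nu setT = 1.
Proof. by rewrite /nu setTI divff// gt_eqF. Qed.

Lemma nu_le1 (A : set config) : nu A <= 1.
Proof. by rewrite -nu_setT; exact: nu_le. Qed.

Definition cut (m : int) (k : nat) : set config := [set z | label z m = k].

(** The map [push_left] sends [cut m k] within the level bijectively onto the configurations counted
    on the left, and multiplies each weight by [q ^+ k]. *)
Lemma nu_push_left (m : int) (k : nat) :
  nu [set z : config | label z m = k /\ ~~ z (m - 1)] = q ^+ k * nu (cut m k).
Proof.
rewrite /nu mulrA; congr (_ / _).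
apply: EFin_inj; rewrite EFinM !fineK ?fin_num_measure//;
  try exact: level_sub_measurable.
have sub (A : set config) : A `&` level `<=` Omega by move=> z [_ []].
rewrite !(measure_Omega_sub mu (sub _)) -ge0_esumZl//; last first.
  by rewrite exprn_ge0// ltW.
rewrite (@reindex_esum _ _ _ (cut m k `&` level) _ (fun z => push_left z m)).
  apply: eq_esum => z [zk [Oz _]].
  have := congr1 EFin (weight_push_left q0 hmu m Oz); rewrite zk EFinM !fineK.
  - by rewrite muleC.
  - by rewrite fin_num_measure//; exact: measurable_config1.
  - by rewrite fin_num_measure//; exact: measurable_config1.
split.
- move=> z [zk [Oz Nz]]; split; last first.
    by split; [exact: Omega_push_left|rewrite N_push_left].
  split; first by rewrite label_push_left.
  by rewrite /push_left ltxx ifT//; lia.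
- by move=> z z' _ _ e; rewrite -(push_leftK z m) e push_leftK.
- move=> z [[zk zm] [Oz Nz]]; exists (pull_right z m); last exact: pull_rightK.
  have Op := Omega_pull_right m Oz.
  split; first by rewrite /cut /= -label_push_left// pull_rightK.
  by split; rewrite // -(N_push_left m Op) pull_rightK.
Qed.

(** The event [cut (m + 1) k.+1] is split according to whether [m] is occupied; the empty part has
    the share [q ^+ k.+1] by [nu_push_left]. *)
Lemma nu_particle (m : int) (k : nat) :
  nu [set z : config | z m /\ label z m = k] =
  (1 - q ^+ k.+1) * nu (cut (m + 1) k.+1).
Proof.
have := nu_setID [set z : config | z m] (cut (m + 1) k.+1).
rewrite (eq_nu (A := _ `&` ~` _)
  (B := [set z : config | label z (m + 1) = k.+1 /\ ~~ z (m + 1 - 1)]))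
  => [|z _ _].
  rewrite nu_push_left (eq_nu (A := _ `&` _)
    (B := [set z : config | z m /\ label z m = k])) => [h|z Oz _]; first lra.
  by rewrite /cut /= label_succ//; split=> -[]; case: (z m) => //; lia.
by rewrite addrK /cut /=; split => -[-> /negP].
Qed.

Lemma nu_cut_rec (m : int) (k : nat) :
  nu (cut m k) = q ^+ k * nu (cut (m + 1) k) +
                 (1 - q ^+ k.+1) * nu (cut (m + 1) k.+1).
Proof.
rewrite -nu_particle -nu_push_left addrK.
rewrite (nu_setID [set z : config | z m]) addrC.
congr (_ + _); apply: eq_nu => z Oz _; rewrite /cut /=.
  rewrite label_succ//; split=> -[zk].
    by move/negP => zm; rewrite (negbTE zm) addn0.
  move=> zm; move: zk; rewrite (negbTE zm) addn0 => ->.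
  by split => //; exact/negP.
by rewrite /cut /=; split => -[].
Qed.

Lemma nu_cut_eq0 (m : int) (k : nat) : n + 1 + k%:Z < m -> nu (cut m k) = 0.
Proof.
move=> nm; rewrite (eq_nu (B := set0)) => [|z Oz Nz].
  by rewrite /nu set0I measure0 mul0r.
by rewrite /cut /=; split => // zk; have := label_lb m Oz; rewrite Nz zk; lia.
Qed.

(** These events increase to the whole level and fix the label at [n + 1 + k]; they supply the
    boundary values of the recursion. *)
Definition full (k : nat) : set config :=
  [set z : config | forall i, n + 1 + k%:Z <= i -> z i].

Lemma full_label (k : nat) (z : config) : Omega z -> N z = n -> full k z ->
  label z (n + 1 + k%:Z) = k.
Proof.
move=> Oz Nz zk; have [M zM] := label_large Oz.
pose j := absz (Num.max M (n + 1 + k%:Z) - (n + 1 + k%:Z))%R.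
have [_] := zM (n + 1 + k%:Z + j%:Z) ltac:(rewrite /j; lia).
rewrite label_addn//.
rewrite (eq_bigr (fun=> 1%N)) => [|i _]; last by rewrite zk//; lia.
by rewrite sum_nat_const card_ord Nz; lia.
Qed.

Lemma nu_full_cvg : nu (full k) @[k --> \oo] --> (1 : R).
Proof.
rewrite -nu_setT; apply: cvgMr_tmp; rewrite setTI; apply: fine_cvg.
rewrite fineK ?fin_num_measure//; last first.
  by have := level_sub_measurable setT; rewrite setTI.
rewrite [X in _ --> mu X](_ : level = \bigcup_k (full k `&` level)).
  apply: (nondecreasing_cvg_mu (F := fun k => full k `&` level : set mconfig)).
  - by move=> k; exact: level_sub_measurable.
  - by apply: bigcupT_measurable => k; exact: level_sub_measurable.
  - apply/nondecreasing_seqP => k; apply/subsetPset => z [zk lz]; split => //.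
    by move=> i ki; apply: zk; lia.
apply/seteqP; split => [z [Oz Nz]|z [k _ []//]].
have [M zM] := label_large Oz; exists (absz (M - n - 1)%R) => //; split => //.
by move=> i hi; have [->] := zM i ltac:(lia).
Qed.

(** In these coordinates [k] is the number of particles left of the cut and [r] the number of holes
    at or to the right of it. *)
Lemma nu_cut_formula (k r : nat) :
  nu (cut (n + 1 + k%:Z - r%:Z) k) =
  qpoch_infty q * q ^+ (k * r) / (qpoch q k * qpoch q r).
Proof.
pose h (j s : nat) := nu (cut (n + 1 + j%:Z - s%:Z) j).
apply: (qpoch_recursion (h := h)) => //; rewrite /h.
- by move=> *; exact: nu_ge0.
- move=> {}k; rewrite nu_cut_rec nu_cut_eq0 ?mulr0 ?add0r; last by lia.
  by congr (_ * nu (cut _ _)); lia.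
- move=> {}k {}r; rewrite nu_cut_rec.
  by congr (_ * nu (cut _ _) + _ * nu (cut _ _)); lia.
- apply: (squeeze_cvgr (f := fun k => nu (full k)) (h := fun=> 1)).
  + apply: nearW => {}k; rewrite nu_le1 andbT; apply: nu_le => z [zk [Oz Nz]].
    by rewrite /cut /= subr0; exact: full_label.
  + exact: nu_full_cvg.
  + exact: cvg_cst.
(* After the shift the cut is at [n + 1 + k] with label [k + r.+1], whereas [full k] forces the
   label [k] there. *)
- move=> {}r; rewrite -(cvg_shiftn r.+1).
  apply: (squeeze_cvgr (f := fun=> 0) (h := fun k => 1 - nu (full k))).
  + apply: nearW => {}k; rewrite nu_ge0 /=.
    have := nu_setID (full k) setT; rewrite nu_setT !setTI => ->.
    rewrite [leRHS]addrAC subrr add0r.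
    apply: nu_le => z [/= zk [Oz Nz]] zf; have := full_label Oz Nz zf.
    move: zk; rewrite /cut /=.
    have -> : n + 1 + (k + r.+1)%:Z - r.+1%:Z = n + 1 + k%:Z by lia.
    by move=> -> ; lia.
  + exact: cvg_cst.
  + rewrite -[X in _ --> X](subrr 1); apply: cvgB; first exact: cvg_cst.
    exact: nu_full_cvg.
Qed.

Lemma nu_particle_formula (m : int) (k r : nat) : r%:Z = n - m + k%:Z + 1 ->
  nu [set z : config | z m /\ label z m = k] =
  qpoch_infty q * q ^+ (k * r + r) / (qpoch q k * qpoch q r).
Proof.
move=> hr; rewrite nu_particle.
have -> : m + 1 = n + 1 + k.+1%:Z - r%:Z by lia.
rewrite nu_cut_formula qpochS mulSn addnC.
have ? : 1 - q ^+ k.+1 != 0 by rewrite gt_eqF// subr_gt0 exprn_ilt1// ltW.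
have ? : qpoch q k != 0 by rewrite gt_eqF// qpoch_gt0.
have ? : qpoch q r != 0 by rewrite gt_eqF// qpoch_gt0.
by field; apply/and3P.
Qed.

Lemma nu_particle_eq0 (m : int) (k : nat) : n - m + k%:Z + 1 < 0 ->
  nu [set z : config | z m /\ label z m = k] = 0.
Proof. by move=> h; rewrite nu_particle nu_cut_eq0 ?mulr0//; lia. Qed.

End Cut.

(** * The stationary law *)

Lemma N_step (n : int) : N (step n) = n.
Proof.
have zM : window (step n) (absz n).+1.
  by move=> i; rewrite /step; split; lia.
have := label_step n (absz n + absz n + 2).
by rewrite (N_label zM (i := n + 1 + (absz n + absz n + 2)%:Z)); lia.
Qed.

Section StationaryLaw.
Variables (R : realType) (q c : R) (mu : probability mconfig R) (n : int).
Hypotheses (q01 : 0 < q < 1) (hmu : is_product_measure q c mu).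
Variables (d : measure_display) (T : measurableType d) (P : probability T R)
  (Z : R -> T -> state).
Hypotheses (hZ : markov_jump_process P (coupled_rate q) Z)
  (hstat : stationary P Z)
  (hxi : forall A : set mconfig, measurable A ->
    P [set w | A (val (Z 0 w).1)] = (conditioned mu n A)%:E).

Let q0 : 0 < q. Proof. by case/andP: q01. Qed.
Let q1 : q < 1. Proof. by case/andP: q01. Qed.

(** If the level were null, division by zero would give 0 for the conditional probability of the
    whole space, whereas [hxi] makes it 1. *)
Lemma level_measure_gt0 : 0 < fine (mu (level n)).
Proof.
have := hxi (@measurableT _ mconfig).
rewrite probability_setT /conditioned setTI.
rewrite -/(level n) => -[]; have := fine_ge0 (measure_ge0 mu (level n)).
rewrite le_eqVlt => /predU1P[<-|//].
by rewrite mul0r => /eqP; rewrite oner_eq0.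
Qed.

Lemma config_weight_gt0 (z : config) : Omega z -> 0 < fine (mu [set z]).
Proof.
move=> Oz; have := level_measure_gt0.
have lO : level n `<=` Omega by move=> y [].
rewrite (measure_Omega_sub mu lO) => pos.
have [[y [Oy yn0]]|none] :=
  pselect (exists y, Omega y /\ fine (mu [set y]) != 0).
  by apply: (weight_pos q0 hmu Oy Oz); rewrite lt_def yn0 fine_ge0.
move: pos; rewrite esum1 ?ltxx// => y /lO Oy.
rewrite -[LHS]fineK; last first.
  by rewrite fin_num_measure//; exact: measurable_config1.
by congr (_%:E); apply/eqP/negPn/negP => yn0; apply: none; exists y.
Qed.

Lemma state_weight_gt0 (s : state) : 0 < state_weight q mu s.
Proof.
by rewrite mulr_gt0 ?exprn_gt0//; apply: config_weight_gt0; exact: set_valP.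
Qed.

Let v (s : state) : R := fine (P [set w | Z 0 w = s]).

Lemma measurable_state (A : set state) : measurable [set w | A (Z 0 w)].
Proof. by case: hZ => mZ _ _; exact: mZ. Qed.

(** The exit rate of [b] times its positive weight is one term of the finite total flux. *)
Lemma exit_rate_lty (b : state) :
  (\esum_(a in [set: state]) (coupled_rate q b a)%:E < +oo)%E.
Proof.
have flux_ge0 e : (0 <= \esum_(a in [set: state])
    (state_weight q mu e * coupled_rate q e a)%:E)%E.
  apply: esum_ge0 => a _; rewrite lee_fin mulr_ge0 ?coupled_rate_ge0//.
  by rewrite ltW// state_weight_gt0.
have := state_weight_rate_sum q01 hmu.
rewrite (esumID [set b])// ?setTI ?esum_set1; last exact: flux_ge0.
set X := (\esum_(i in ~` _) _)%E => fin.
have X0 : (0 <= X)%E.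
  by apply: esum_ge0 => e _; exact: flux_ge0.
have {fin} : ((state_weight q mu b)%:E *
    (\esum_(a in [set: state]) (coupled_rate q b a)%:E) < +oo)%E.
  rewrite -ge0_esumZl ?ltW ?state_weight_gt0//; last first.
    by move=> a; rewrite lee_fin coupled_rate_ge0.
  by apply: le_lt_trans fin; rewrite leeDl.
apply: contraTT; rewrite -!leNgt !leye_eq => /eqP ->.
by rewrite gt0_muley// lte_fin state_weight_gt0.
Qed.

Lemma ratio_edge (a b : state) : 0 < coupled_rate q a b ->
  v a / state_weight q mu a = v b / state_weight q mu b.
Proof.
apply: reversible_ratio_eq => //.
- by move=> *; exact: coupled_rate_ge0.
- exact: state_weight_gt0.
- by move=> *; exact: fine_ge0.
- exact: (state_weight_balance q01 hmu).
- exact: (state_weight_rate_sum q01 hmu).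
- move=> s; apply: (stationary_rate_subinvariant hZ hstat).
  + by move=> *; exact: coupled_rate_diag.
  + by move=> *; exact: coupled_rate_ge0.
  + exact: exit_rate_lty.
Qed.

(** The law is indexed by plain configurations, without a proof of membership in [Omega], so that
    [exchange_connected] applies to [ratio]. *)
Let vC (z : config) (x : nat) : R :=
  fine (P [set w | val (Z 0 w).1 = z /\ (Z 0 w).2 = x]).

Let vE (z : config) (Oz : Omega z) (x : nat) :
  vC z x = v (SigSub (mem_set Oz), x).
Proof.
rewrite /vC /v; congr (fine (P _)); apply/seteqP; split => w /=.
  by case: (Z 0 w) => y k /= [yz ->]; congr (_, _); exact: val_Omega_inj.
by move=> ->.
Qed.

Let ratio (z : config) (x : nat) : R := vC z x / (fine (mu [set z]) * q ^+ x).

Let ratioE (z : config) (Oz : Omega z) (x : nat) :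
  ratio z x = v (SigSub (mem_set Oz), x) /
              state_weight q mu (SigSub (mem_set Oz), x).
Proof. by rewrite /ratio (vE Oz). Qed.

Lemma ratio_exchange (z : config) (i : int) (x : nat) :
  Omega z -> z i -> ~~ z (i + 1) -> ratio z x = ratio (exchange z i) x.
Proof.
move=> Oz zi zi1; rewrite (ratioE Oz) (ratioE (Omega_exchange i Oz)).
apply: ratio_edge; rewrite /coupled_rate /= eqxx asep_rate_exchange.
  rewrite zi ltr_wpDr//; case: ifP => // _; exact: label_rate_ge0.
by rewrite zi (negbTE zi1).
Qed.

(** In the step configuration consecutive labels sit on neighbouring sites, so every label move is
    allowed. *)
Lemma ratio_label (x : nat) : ratio (step n) x = ratio (step n) 0%N.
Proof.
elim: x => // x <-; rewrite !(ratioE (Omega_step n)); apply/esym/ratio_edge.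
rewrite /coupled_rate /= eqxx ltr_wpDl//.
  by case: ifP => // _; exact: asep_rate_ge0.
rewrite /label_rate /neighbours !position_step ifT ?eqxx//.
by apply/eqP; lia.
Qed.

Lemma ratio_const (z : config) (x : nat) : Omega z -> N z = n ->
  ratio z x = ratio (step n) 0%N.
Proof.
move=> Oz Nz; rewrite -(ratio_label x).
apply: (@exchange_connected _ n (fun y => ratio y x)) => // y i Oy _.
exact: ratio_exchange.
Qed.

Lemma marginal_esum (z : config) : Omega z ->
  (P [set w | val (Z 0%R w).1 = z] = \esum_(x in [set: nat]) (vC z x)%:E)%E.
Proof.
move=> Oz; pose A : set state := [set s | val s.1 = z].
have cA : countable A.
  exact: sub_countable (subset_card_le (@subsetT _ A)) countable_state.
have mA (s : state) : A s -> measurable (Z 0 @^-1` [set s]).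
  by move=> _; exact: (measurable_state [set s]).
rewrite [LHS](measure_countable_preimage P cA mA).
rewrite (@reindex_esum _ _ _ [set: nat] _
  (fun x => (SigSub (mem_set Oz), x) : state)).
  apply: eq_esum => x _; rewrite (vE Oz) /v fineK//.
  by rewrite fin_num_measure//; exact: (measurable_state [set _]).
split => //=; first by move=> x y _ _ [].
by move=> [y x] /= yz; exists x => //; congr (_, _); exact: val_Omega_inj.
Qed.

Lemma marginal_config (z : config) :
  P [set w | val (Z 0 w).1 = z] = (nu mu n [set z])%:E.
Proof. by rewrite (hxi (measurable_config1 z)). Qed.

(** Summing over the labels at the step configuration must give its mass under [nu mu n]; the
    geometric series produces the factor [1 - q]. *)
Lemma ratio_value : ratio (step n) 0%N = (1 - q) / fine (mu (level n)).
Proof.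
have Os := Omega_step n; have w0 := config_weight_gt0 Os.
have l0 := level_measure_gt0.
have := marginal_config (step n); rewrite marginal_esum//.
rewrite (eq_esum (b := fun x =>
    ((ratio (step n) 0%N * fine (mu [set step n]))%:E * (q ^+ x)%:E)%E))
  => [|x _]; last first.
  rewrite -(ratio_label x) -EFinM /ratio; congr (_%:E); field.
  by rewrite !gt_eqF ?exprn_gt0.
rewrite ge0_esumZl; last 2 first.
- rewrite mulr_ge0 ?fine_ge0// /ratio divr_ge0 ?fine_ge0//.
  by rewrite mulr_ge0 ?fine_ge0.
- by move=> x; rewrite lee_fin exprn_ge0// ltW.
rewrite esum_geometric ?q1 ?ltW// -EFinM => -[].
rewrite /nu (_ : [set step n] `&` level n = [set step n]); last first.
  apply/seteqP; split => [z []//|z ->]; split => //.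
  by split => //; exact: N_step.
have nq : 1 - q != 0 by rewrite gt_eqF// subr_gt0.
move=> h; apply: (mulIf (lt0r_neq0 w0)); apply: (mulIf (invr_neq0 nq)).
by rewrite h; field; rewrite nq gt_eqF.
Qed.

Lemma stationary_law (z : config) (x : nat) : Omega z ->
  vC z x = (1 - q) * q ^+ x * nu mu n [set z].
Proof.
move=> Oz; have w0 := config_weight_gt0 Oz.
have l0 := level_measure_gt0.
have [Nz|Nz] := eqVneq (N z) n.
  have := ratio_const x Oz Nz; rewrite ratio_value /ratio.
  rewrite /nu (_ : [set z] `&` level n = [set z]); last first.
    by apply/seteqP; split => [y []//|y ->].
  move=> /(congr1 (fun r => r * (fine (mu [set z]) * q ^+ x))).
  rewrite divfK => [->|]; last by rewrite mulf_neq0// gt_eqF// exprn_gt0.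
  by field; rewrite gt_eqF.
(* Off the level, the marginal gives [z] no mass, hence neither does the joint law. *)
have nu0 : nu mu n [set z] = 0.
  rewrite /nu (_ : [set z] `&` level n = set0) ?measure0 ?mul0r//.
  by apply/seteqP; split => // y [-> [_ Nz']]; rewrite Nz' eqxx in Nz.
rewrite nu0 mulr0; apply/eqP; rewrite eq_le fine_ge0// andbT.
rewrite -lee_fin /vC fineK; last first.
  rewrite fin_num_measure//.
  exact: (measurable_state [set s | val s.1 = z /\ s.2 = x]).
have := marginal_config z; rewrite nu0 => <-; apply: le_measure; rewrite ?inE.
- exact: (measurable_state [set s | val s.1 = z /\ s.2 = x]).
- exact: (measurable_state [set s | val s.1 = z]).
- by move=> w [].
Qed.

Lemma site_prob (m : int) (t : R) : 0 <= t ->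
  (P [set w | second_class_site (Z t w) = m] =
   \esum_(k in [set: nat])
     ((1 - q) * q ^+ k * nu mu n [set z : config | z m /\ label z m = k])%:E)%E.
Proof.
move=> t0.
pose A : set state := [set s | second_class_site s = m].
have -> : P [set w | second_class_site (Z t w) = m] = P (Z 0 @^-1` A).
  exact: (hstat A t0).
have cA : countable A.
  exact: sub_countable (subset_card_le (@subsetT _ A)) countable_state.
rewrite (measure_countable_preimage P cA) => [|s _]; last first.
  exact: (measurable_state [set s]).
pose B k : set config := [set z : config | z m /\ label z m = k].
pose F (z : config) (k : nat) : \bar R :=
  if position z k == m then ((1 - q) * q ^+ k * nu mu n [set z])%:E else 0%E.
have F0 z k : (0 <= F z k)%E.
  rewrite /F; case: ifP => // _; rewrite lee_fin mulr_ge0 ?nu_ge0//.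
  by rewrite mulr_ge0 ?exprn_ge0 ?subr_ge0// ltW.
rewrite esum_mkcond.
rewrite (eq_esum (b := fun s : state => F (val s.1) s.2)); last first.
  move=> [[z Oz] k] _; rewrite /F; have Oz' := set_mem Oz.
  rewrite (_ : _ \in A = (position z k == m)); last first.
    by apply/idP/eqP; rewrite inE.
  case: ifP => // _; rewrite -stationary_law//.
  rewrite (vE Oz') /v fineK; last first.
    by rewrite fin_num_measure//; exact: (measurable_state [set _]).
  congr (P _); apply/seteqP.
  by split => w /= ->; congr (_, _); exact: val_Omega_inj.
rewrite esum_state// esum_exchange//; apply: eq_esum => k _.
have nz0 : 0 <= (1 - q) * q ^+ k.
  by rewrite mulr_ge0 ?exprn_ge0 ?subr_ge0// ltW.
rewrite EFinM (_ : (nu mu n (B k))%:E = \esum_(z in Omega)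
    (if position z k == m then (nu mu n [set z])%:E else 0))%E.
  rewrite -ge0_esumZl// => [|z]; last first.
    by case: ifP => // _; rewrite lee_fin nu_ge0.
  by apply: eq_esum => z _; rewrite /F; case: ifP; rewrite ?mule0// EFinM.
have lV : 0 <= (fine (mu (level n)))^-1 by rewrite invr_ge0 fine_ge0.
have finmu (C : set mconfig) : C `<=` Omega -> (fine (mu C))%:E = mu C.
  by move=> CO; rewrite fineK// fin_num_measure//; exact: Omega_sub_measurable.
have BO : B k `&` level n `<=` Omega by move=> z [_ []].
rewrite /nu mulrC EFinM finmu// (measure_Omega_sub mu BO) -ge0_esumZl//.
rewrite [LHS]esum_mkcond [RHS]esum_mkcond; apply: eq_esum => z _.
case: (boolP (z \in Omega)) => [/set_mem Oz|]; last first.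
  rewrite notin_setE => nOz; rewrite ifN// notin_setE => -[_ []].
  by move=> /nOz.
case: (boolP (z \in _)) => [|]; last first.
  rewrite notin_setE => nB; case: eqP => // /(positionP k m Oz) pz.
  rewrite (_ : [set z] `&` level n = set0) ?measure0 ?mul0r//.
  by apply/seteqP; split => // y [/= -> lz]; apply: nB.
rewrite inE => -[Bz lz]; rewrite ifT; last exact/eqP/positionP.
rewrite (_ : [set z] `&` level n = [set z]); last first.
  by apply/seteqP; split => [y []//|y ->].
by rewrite [RHS]EFinM finmu; [exact: muleC|move=> y ->].
Qed.

End StationaryLaw.

(** * Summation over the label of the second class particle *)

Theorem proposition1p7 (R : realType) (q : R) (hq : 0 < q < 1) (n : int)
    (c : R) (mu : probability mconfig R) (hmu : is_product_measure q c mu)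
    (d : measure_display) (T : measurableType d) (P : probability T R)
    (Z : R -> T -> state)
    (hZ : markov_jump_process P (coupled_rate q) Z)
    (hstat : stationary P Z)
    (hxi : forall A : set mconfig, measurable A ->
       P [set w | A (val (Z 0 w).1)] = (conditioned mu n A)%:E)
    (m : int) (t : R) (ht : 0 <= t) :
  P [set w | second_class_site (Z t w) = m] =
  (((1 - q) * qpoch_infty q)%:E *
   \sum_(absz (Num.max (m - n - 1) 0)%R <= k <oo)
     (let r := absz (n - m + k%:Z + 1) in
      q ^+ (k * r + k + r) / (qpoch q k * qpoch q r))%:E)%E.
Proof.
have /andP[q0 q1] := hq.
have mu_level := level_measure_gt0 hxi.
rewrite (site_prob hq hmu hZ hstat hxi m ht).
set M := absz _.
set u := fun k : nat => let r := absz (n - m + k%:Z + 1) in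
  q ^+ (k * r + k + r) / (qpoch q k * qpoch q r).
have u0 k : 0 <= u k.
  by rewrite /u /= divr_ge0 ?mulr_ge0 ?exprn_ge0 ?ltW ?qpoch_gt0.
(* The sign is read off from a probability: for [m = n + 1] and [k = r = 0] the formula reduces to
   [qpoch_infty q]. *)
have C0 : 0 <= (1 - q) * qpoch_infty q.
  have := nu_particle_formula hq hmu mu_level (m := n + 1) (k := 0) (r := 0).
  rewrite /qpoch !big_geq// !mulr1 divr1 => <-; last by lia.
  by rewrite mulr_ge0 ?nu_ge0// subr_ge0 ltW.
(* For [k < M] the number of holes right of [m] would be negative, so the event is null; from [M]
   on, [absz] leaves that number unchanged. *)
have termE k :
    (1 - q) * q ^+ k * nu mu n [set z : config | z m /\ label z m = k] =
    if (k < M)%N then 0 else (1 - q) * qpoch_infty q * u k.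
  case: ltnP => kM.
    rewrite (nu_particle_eq0 hq hmu mu_level) ?mulr0//.
    by move: kM; rewrite /M; lia.
  have hr : (absz (n - m + k%:Z + 1))%:Z = n - m + k%:Z + 1.
    by move: kM; rewrite /M; lia.
  rewrite (nu_particle_formula hq hmu mu_level hr) /u /=.
  by rewrite !exprD; ring.
rewrite -nneseries_esumT => [|k]; last first.
  rewrite lee_fin termE; case: ifP => // _; exact: mulr_ge0 C0 (u0 k).
rewrite (nneseries_split 0 M) => [|k _]; last first.
  rewrite lee_fin termE; case: ifP => // _; exact: mulr_ge0 C0 (u0 k).
rewrite add0n big_nat big1 ?add0e => [|k /andP[_ kM]]; last first.
  by rewrite termE kM.
rewrite -nneseriesZl => [|k _]; last by rewrite lee_fin; exact: u0.
apply/congr_lim/funext => j; rewrite big_nat [RHS]big_nat.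
by apply: eq_bigr => k /andP[Mk _]; rewrite termE ltnNge Mk /= EFinM.
Qed.
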